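(* Let $1\le s\le n$, let $s$ algebraic hypersurfaces without multiple factors $f_1(X)=0,\dots,f_s(X)=0$ in $\mathbb{C}^n$, of degrees $k_1,\dots,k_s$ respectively, sufficiently intersect at the algebraic manifold $S_{n-s}=s(f_1,\dots,f_s)$, and let $m$ be a nonnegative integer. Then the dimension of the polynomial space $\mathbb{P}_m^{(n)}$ along $S_{n-s}$ is $$\dim\big(\mathbb{P}_m^{(n)}|_{s(f_1,\dots,f_s)}\big)=\sum_{j=0}^m h_j(s),$$ where $h_j(s)$ is the coefficient of $t^j$ in the power series expansion of $(1-t^{k_1})\cdots(1-t^{k_s})(1-t)^{-n}$.
   Context: $X=(x_1,\dots,x_n)$. $\mathbb{P}_m^{(n)}$ is the complex vector space of polynomials in $\mathbb{C}[x_1,\dots,x_n]$ of total degree $\le m$. $s(f_1,\dots,f_s)$ is the set of common zeros of $f_1,\dots,f_s$ in $\mathbb{C}^n$. $\mathbb{P}_m^{(n)}|_S$ is the vector space of restrictions to $S$ of the polynomials in $\mathbb{P}_m^{(n)}$. A hypersurface $f(X)=0$ is without multiple factors if $f$ has no repeated non-constant factor. Sufficient intersection: hypersurfaces $f_1=0,\dots,f_s=0$ of degrees $k_1,\dots,k_s$ in $\mathbb{C}^n$ ($1\le s\le n$) sufficiently intersect at $s(f_1,\dots,f_s)$ if there exist $n-s$ hypersurfaces $f_{s+1}=0,\dots,f_n=0$ of degrees $k_{s+1},\dots,k_n$ such that $f_1=0,\dots,f_n=0$ meet exactly at $k_1\cdots k_n$ mutually distinct points of $\mathbb{C}^n$.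 *)

(* Defs.v *)
From mathcomp Require Import all_boot all_order all_algebra.
From mathcomp Require Export mpoly complex.
From mathcomp Require Export reals.

Set Implicit Arguments.
Unset Strict Implicit.
Unset Printing Implicit Defensive.

Import GRing.Theory.
Local Open Scope ring_scope.

Section Hypersurfaces.
Variables (n : nat) (K : fieldType).
Implicit Types (p f g h : {mpoly K[n]}) (x : 'rV[K]_n).

(* [msize] is the total degree plus one, and [msize 0 = 0]. *)
Definition degree_le m p := (msize p <= m.+1)%N.

Definition hypersurface k f := (0 < k)%N && (msize f == k.+1).

Definition without_multiple_factors f :=
  forall g h, f = g ^+ 2 * h -> (msize g <= 1)%N.

Definition common_zero s (f : 'I_s -> {mpoly K[n]}) x : bool :=
  [forall i, (f i).@[x 0] == 0].

Definition zero_locus s (f : 'I_s -> {mpoly K[n]}) := {x | common_zero f x}.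

Definition sufficiently_intersect s (k : 'I_s -> nat)
    (f : 'I_s -> {mpoly K[n]}) :=
  exists (l : 'I_(n - s) -> nat) (g : 'I_(n - s) -> {mpoly K[n]}),
    (forall i, hypersurface (l i) (g i)) /\
    exists pts : seq 'rV[K]_n,
      [/\ uniq pts,
          size pts = ((\prod_i k i) * (\prod_i l i))%N
        & forall x, (x \in pts) = common_zero f x && common_zero g x].

Definition restrictions (m s : nat) (f : 'I_s -> {mpoly K[n]})
    (phi : zero_locus f -> K) : Prop :=
  exists2 p, degree_le m p &
    forall x : zero_locus f, phi x = p.@[sval x 0].

End Hypersurfaces.

Arguments restrictions {n K} m {s} f phi.

(* [V] is meant to be a linear subspace of the space of functions [S -> K];
   the dimension is given by a basis indexed by ['I_d]. *)
Definition has_dim (S : Type) (K : fieldType) (V : (S -> K) -> Prop) (d : nat) :=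
  exists b : 'I_d -> S -> K,
    [/\ forall i, V (b i),
        forall c : 'I_d -> K,
          (forall x, \sum_i c i * b i x = 0) -> forall i, c i = 0
      & forall phi, V phi ->
          exists c : 'I_d -> K, forall x, phi x = \sum_i c i * b i x].

(* A formal power series is given by its sequence of coefficients. *)
Definition fps := nat -> int.

Definition fps_of_poly (p : {poly int}) : fps := fun j => p`_j.

Definition fps_mul (a b : fps) : fps :=
  fun j => \sum_(i < j.+1) a i * b (j - i)%N.

Fixpoint fps_inv_coefs (a : fps) (j : nat) : seq int :=
  if j is j'.+1 then
    let b := fps_inv_coefs a j' in
    rcons b ((j' == 0)%:R - \sum_(i < j') a (j' - i)%N * b`_i)
  else [::].

(* The inverse of a series with constant coefficient 1: see [fps_mulV]. *)
Definition fps_inv (a : fps) : fps := fun j => (fps_inv_coefs a j.+1)`_j.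

Lemma size_fps_inv_coefs a j : size (fps_inv_coefs a j) = j.
Proof. by elim: j => //= j IHj; rewrite size_rcons IHj. Qed.

Lemma nth_fps_inv_coefs a i j :
  (i < j)%N -> (fps_inv_coefs a j)`_i = fps_inv a i.
Proof.
elim: j => // j IHj; rewrite ltnS leq_eqVlt => /orP[/eqP-> //|lt_ij].
by rewrite /= nth_rcons size_fps_inv_coefs lt_ij IHj.
Qed.

Lemma fps_mulV a j :
  a 0%N = 1 -> fps_mul a (fps_inv a) j = (j == 0)%:R.
Proof.
move=> a0; rewrite /fps_mul big_ord_recl a0 mul1r subn0.
rewrite {1}/fps_inv /= nth_rcons size_fps_inv_coefs ltnn eqxx.
rewrite -[RHS](subrK (\sum_(i < j) a (j - i)%N * (fps_inv_coefs a j)`_i)).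
congr (_ + _); rewrite [RHS](reindex_inj rev_ord_inj) /=.
apply: eq_bigr => i _; rewrite nth_fps_inv_coefs ?rev_ord_proof //.
by rewrite /bump /= add1n subKn.
Qed.

(* The coefficient of t^j in (1 - t^k_1) ... (1 - t^k_s) (1 - t)^(-n). *)
Definition hilb_coef (n s : nat) (k : 'I_s -> nat) (j : nat) : int :=
  fps_mul (fps_of_poly (\prod_i (1 - 'X^(k i))))
          (fps_inv (fps_of_poly ((1 - 'X) ^+ n))) j.

(* Main.v *)
Require Import Defs.
From HB Require Import structures.
From mathcomp Require Import all_boot all_order all_algebra.
From mathcomp Require Import mpoly complex reals boolp.
From mathcomp Require Import zify ring.

Set Implicit Arguments.
Unset Strict Implicit.
Unset Printing Implicit Defensive.

Import Order.TTheory GRing.Theory Num.Theory.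
Local Open Scope ring_scope.

(** Let [S] be the zero locus of [f_1, ..., f_s], complete these by
    [f_(s+1), ..., f_n] to a system with [D = k_1 ... k_n] distinct zeros, and
    homogenise everything with a new variable [x_n]: [F_1, ..., F_n] are forms
    in [n + 1] variables, and polynomials of degree at most [m] become forms of
    degree [m].

    The theorem says that the forms of degree [m] vanishing on [S] are those of
    the ideal [(F_1, ..., F_s)] and that this ideal has the Hilbert function of
    a complete intersection: the partial sum of the [h_j(s)] is the coefficient
    of [t^m] in [\prod_(i <= s) (1 - t^(k_i)) (1 - t)^(-n-1)]. Both facts follow
    once [x_n, F_1, ..., F_n] is known to be a regular sequence.

    - No zero at infinity ([no_zero_at_infinity]). The number of zeros being
      maximal, the [F_i] have no common zero with [x_n = 0]. Filter the
      polynomials in [n] variables by the weight of the products [f^a], where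
      [f_i] has weight [k_i]. The [D] zeros force the quotients by the steps of
      the filtration to be large, namely of dimension at least the number of
      monomials of degree less than [w] ([leq_card_exponents], which rests on
      [analytic_independence]). A zero at infinity forces them to be small: in
      coordinates where it is the direction [x_j], every [f_i] has degree less
      than [k_i] in [x_j], so the remainders miss a whole corner of the space of
      polynomials of degree about [w] ([reduce_support], [exponents_region]).

    - Regularity ([only_trivial_zero_regular]). As many forms as variables,
      without a nontrivial common zero, are a regular sequence. They are
      replaced one at a time by linear forms; if [l] and [x] both complete the
      other forms to a system without zeros and [l] is a nonzerodivisor modulo
      these, then so is [x], because a power of [l] is a multiple of [x] by the
      Nullstellensatz. Regular sequences are described by their Hilbert
      function, which makes their independence of the order evident
      ([regular_forms_behead], [regular_forms_nzd]).

    - Radicality. Modulo [(F_1, ..., F_n)] the Hilbert function is at most [D],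
      and the [D] points impose [D] conditions on forms of large degree; hence
      the forms vanishing at the points are those of the ideal
      ([vanish_pts_ideal]). That an ideal contains every form of which it
      contains a power descends from [(F_1, ..., F_(r+1))] to
      [(F_1, ..., F_r)], since [F_(r+1)] is a nonzerodivisor
      ([homog_radical_behead]). With the Nullstellensatz this identifies the
      forms vanishing on [S] ([vanish_locus_ideal]).

    The Nullstellensatz is proved by induction on the number of variables, with
    a determinant in place of a resultant ([specialization_proper]). *)

(** * Ideals *)

Definition ideal (A : comNzRingType) (I : A -> Prop) :=
  [/\ I 0, forall a b, I a -> I b -> I (a + b) & forall a b, I b -> I (a * b)].

Section Ideals.
Variables (A : comNzRingType) (I : A -> Prop).
Hypothesis idI : ideal I.

Lemma ideal0 : I 0. Proof. by case: idI. Qed.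

Lemma idealD a b : I a -> I b -> I (a + b).
Proof. by case: idI => _ + _; apply. Qed.

Lemma idealMl a b : I b -> I (a * b).
Proof. by case: idI => _ _; apply. Qed.

Lemma idealMr a b : I a -> I (a * b).
Proof. by rewrite mulrC; apply: idealMl. Qed.

Lemma idealN a : I a -> I (- a).
Proof. by rewrite -mulN1r; apply: idealMl. Qed.

Lemma idealB a b : I a -> I b -> I (a - b).
Proof. by move=> Ia Ib; apply: idealD => //; apply: idealN. Qed.

Lemma ideal_sum (T : Type) (r : seq T) (P : pred T) (F : T -> A) :
  (forall i, P i -> I (F i)) -> I (\sum_(i <- r | P i) F i).
Proof. by apply: big_ind; [exact: ideal0 | exact: idealD]. Qed.

Lemma ideal_proper a b : ~ I 1 -> a * b = 1 -> ~ I a.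
Proof. by move=> I1 ab1 Ia; apply: I1; rewrite -ab1; apply: idealMr. Qed.

End Ideals.

(** * The Nullstellensatz *)


Section Evaluation.
Variables (n : nat) (K : fieldType).

Lemma mpoly_rmorph_ext (B : comNzRingType) (f g : {rmorphism {mpoly K[n]} -> B}) :
  (forall c, f c%:MP = g c%:MP) -> (forall i, f 'X_i = g 'X_i) -> f =1 g.
Proof.
move=> fgC fgX p; rewrite (mpolyE p) !rmorph_sum; apply: eq_bigr => m _ /=.
rewrite -mul_mpolyC !rmorphM fgC mpolyXE_id !rmorph_prod; congr (_ * _).
by apply: eq_bigr => i _; rewrite !rmorphXn /= fgX.
Qed.

Lemma meval_dhomogZ d (p : {mpoly K[n]}) (v : 'I_n -> K) a :
  p \is d.-homog -> p.@[fun i => a * v i] = a ^+ d * p.@[v].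
Proof.
move=> /dhomogP hp; rewrite !mevalE mulr_sumr !big_seq; apply: eq_bigr => m /hp /= md.
rewrite mulrCA; congr (_ * _); rewrite -md mdegE -prodrXr -big_split /=.
by apply: eq_bigr => i _; rewrite exprMn.
Qed.

End Evaluation.

(** [K[x_0..x_n]] is read as [K[x_0..x_(n-1)][x_n]] after the substitution
    [x_i -> x_i + c_i x_n] for [i < n]. *)
Section Shear.
Variables (n : nat) (K : fieldType) (c : 'I_n -> K).
Local Notation A := {mpoly K[n]}.

Definition extend_pt (v : 'I_n -> K) (t : K) (i : 'I_n.+1) : K :=
  if unlift ord_max i is Some j then v j else t.

Definition shear_var (i : 'I_n.+1) : {poly A} :=
  if unlift ord_max i is Some j then ('X_j)%:P + (c j)%:MP *: 'X else 'X.

Definition shear : {mpoly K[n.+1]} -> {poly A} :=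
  mmap (polyC \o @mpolyC n K) shear_var.

HB.instance Definition _ := GRing.RMorphism.copy shear (mmap (polyC \o @mpolyC n K)
  shear_var).

Definition unshear_coef : A -> {mpoly K[n.+1]} :=
  mmap (@mpolyC n.+1 K) (fun j => 'X_(lift ord_max j) - c j *: 'X_ord_max).

HB.instance Definition _ := GRing.RMorphism.copy unshear_coef
  (mmap (@mpolyC n.+1 K) (fun j => 'X_(lift ord_max j) - c j *: 'X_ord_max)).

Definition unshear : {poly A} -> {mpoly K[n.+1]} :=
  horner_eval 'X_ord_max \o map_poly unshear_coef.

HB.instance Definition _ := GRing.RMorphism.copy unshear
  (horner_eval ('X_ord_max : {mpoly K[n.+1]}) \o map_poly unshear_coef).

Lemma shearX i : shear 'X_i = shear_var i.
Proof. by rewrite /shear mmapX mmap1U. Qed.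

Lemma shearC a : shear a%:MP = (a%:MP)%:P.
Proof. by rewrite /shear mmapC. Qed.

Lemma unshear_polyC a : unshear a%:P = unshear_coef a.
Proof. by rewrite /unshear /= map_polyC /= /horner_eval hornerC. Qed.

Lemma unshear_X : unshear 'X = 'X_ord_max.
Proof. by rewrite /unshear /= map_polyX /horner_eval hornerX. Qed.

Lemma shearK : cancel shear unshear.
Proof.
apply: (@mpoly_rmorph_ext _ _ _ (unshear \o shear) idfun) => [a|i] /=.
  by rewrite shearC unshear_polyC /unshear_coef mmapC.
rewrite shearX /shear_var; case: unliftP => [j|] ->; last exact: unshear_X.
rewrite -mul_polyC rmorphD rmorphM /= !unshear_polyC unshear_X.
by rewrite /unshear_coef mmapC mmapX mmap1U mul_mpolyC subrK.
Qed.

Lemma shear_unshear_coef a : shear (unshear_coef a) = a%:P.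
Proof.
pose F : {rmorphism A -> {poly A}} := shear \o unshear_coef.
pose G : {rmorphism A -> {poly A}} := polyC.
apply: (mpoly_rmorph_ext (f := F) (g := G)) => [b|j].
  by rewrite /F /= /unshear_coef mmapC shearC.
rewrite /F /= /unshear_coef mmapX mmap1U -mul_mpolyC rmorphB rmorphM /=.
rewrite !shearX shearC /shear_var liftK unlift_none.
by rewrite -mul_polyC addrK.
Qed.

Lemma shear_eval p v t :
  (map_poly (meval v) (shear p)).[t] =
  p.@[extend_pt (fun j => v j + c j * t) t].
Proof.
pose f := horner_eval t \o map_poly (meval v) \o shear.
apply: (@mpoly_rmorph_ext _ _ _ f
          (meval (extend_pt (fun j => v j + c j * t) t))) => [a|i] /=.
  by rewrite /f /= shearC map_polyC /= /horner_eval hornerC !mevalC.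
rewrite /f /= shearX /shear_var mevalXU /extend_pt; case: unliftP => [j|] _.
  rewrite rmorphD /= map_polyC /= -mul_polyC rmorphM /= map_polyC /= map_polyX.
  by rewrite /horner_eval !hornerE /= mevalXU mevalC.
by rewrite map_polyX /horner_eval hornerX.
Qed.

(** In a direction [(c, 1)] where the top form of [p] does not vanish, the
    sheared polynomial is therefore monic up to a constant. *)
Lemma shear_top p d : (msize p <= d.+1)%N ->
  (size (shear p) <= d.+1)%N /\
  (shear p)`_d = ((pihomog mdeg d p).@[extend_pt c 1])%:MP.
Proof.
pose top d (q : {poly A}) a := (size q <= d.+1)%N /\ q`_d = a%:MP.
have topM d1 d2 q1 q2 a1 a2 : top d1 q1 a1 -> top d2 q2 a2 ->
    top (d1 + d2)%N (q1 * q2) (a1 * a2).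
  move=> [sz1 co1] [sz2 co2]; split.
    by apply: leq_trans (size_polyMleq _ _) _; move: sz1 sz2; lia.
  have lt1 : (d1 < (d1 + d2).+1)%N by rewrite ltnS leq_addr.
  rewrite coefM (bigD1 (Ordinal lt1)) //= addKn co1 co2 rmorphM /= big1 ?addr0 //.
  move=> i; rewrite -val_eqE /= neq_ltn => /orP[lti|gti].
    rewrite (nth_default _ (s := q2)) ?mulr0 // (leq_trans sz2) //.
    by move: lti; lia.
  by rewrite (nth_default _ (s := q1)) ?mul0r // (leq_trans sz1).
have topX (i : 'I_n.+1) e : top e (shear_var i ^+ e) (extend_pt c 1 i ^+ e).
  elim: e => [|e IHe]; first by rewrite !expr0; split;
    rewrite ?size_poly1 ?coef1 ?rmorph1.
  rewrite !exprS -add1n; apply: topM => //; rewrite /shear_var /extend_pt.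
  case: unliftP => [j|] _; last by split; rewrite ?size_polyX ?coefX ?rmorph1.
  split; last by rewrite coefD coefC coefZ coefX /= add0r mulr1.
  rewrite (leq_trans (size_polyD _ _)) // geq_max (leq_trans (size_polyC_leq1 _)) //.
  by rewrite (leq_trans (size_scale_leq _ _)) // size_polyX.
have topm m : top (mdeg m) (shear 'X_[m]) ('X_[m].@[extend_pt c 1]).
  rewrite /shear mmapX mevalX /mmap1 mdegE.
  apply: (big_ind3 (fun e q a => top e q a)) => // [|e1 q1 a1 e2 q2 a2]; last exact: topM.
  by split; rewrite ?size_poly1 ?coef1 ?rmorph1.
move=> szp.
have -> : shear p = \sum_(m : 'X_{1..n.+1 < d.+1}) (p@_m)%:MP *: shear 'X_[m].
  rewrite {1}(mpolywE szp) rmorph_sum; apply: eq_bigr => m _ /=.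
  by rewrite -mul_mpolyC rmorphM /= shearC mul_polyC.
split.
  apply: (leq_trans (size_sum _ _ _)); apply/bigmax_leqP => m _.
  rewrite (leq_trans (size_scale_leq _ _)) //.
  by have [+ _] := topm m; move/leq_trans; apply; exact: bmdeg.
rewrite coef_sum (pihomogwE _ _ szp) (raddf_sum (meval _)) (raddf_sum (@mpolyC n K)).
rewrite [RHS]big_mkcond /=.
apply: eq_bigr => m _; rewrite coefZ; have [szm com] := topm m.
case: eqP => [ed|/eqP ne]; first by move: com; rewrite ed => ->; rewrite mevalZ rmorphM.
rewrite nth_default ?mulr0 // (leq_trans szm) //.
by rewrite ltn_neqAle ne -ltnS bmdeg.
Qed.

End Shear.

Section Nullstellensatz.
Variable K : closedFieldType.

Definition has_zero n (I : {mpoly K[n]} -> Prop) :=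
  exists v : 'I_n -> K, forall p, I p -> p.@[v] = 0.

(** An element of least size divides all others and, the ideal being proper,
    is not a constant: its roots are common to the whole ideal. *)
Lemma poly_ideal_root (I : {poly K} -> Prop) (f : {poly K}) :
  ideal I -> ~ I 1 -> I f -> f != 0 -> exists c, forall q, I q -> q.[c] = 0.
Proof.
move=> idI I1 If f0.
have exP : exists k, `[< exists2 h, I h /\ h != 0 & size h = k >].
  by exists (size f); apply/asboolP; exists f.
have [k /asboolP[h [Ih h0] szh] hmin] := ex_minnP exP.
have hdvd q : I q -> h %| q.
  move=> Iq; rewrite /dvdp; apply/negPn/negP => m0.
  have: (k <= size (q %% h)%R)%N.
    apply: hmin; apply/asboolP; exists (q %% h) => //; split=> //.
    have -> : q %% h = q - (q %/ h) * h by rewrite {2}(divp_eq q h) addrC addKr.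
    by apply: (idealB idI) => //; apply: idealMl.
  by rewrite leqNgt -szh ltn_modp h0.
have szh1 : size h != 1%N.
  apply/eqP => /eqP/size_poly1P[c c0 hc]; apply: I1.
  have -> : 1 = c^-1%:P * h by rewrite hc -polyCM mulVf.
  exact: idealMl.
have /closed_rootP[c /rootP hc] := szh1.
exists c => q /hdvd/dvdpP[r ->]; by rewrite hornerM hc mulr0.
Qed.

Section OneVariable.
Variables (n : nat) (J : {poly {mpoly K[n]}} -> Prop) (f : {poly {mpoly K[n]}}).
Hypotheses (idJ : ideal J) (J1 : ~ J 1) (Jf : J f) (fm : f \is monic).
Variable v : 'I_n -> K.
Hypothesis v0 : forall a, J a%:P -> a.@[v] = 0.

Local Notation ev := (map_poly (meval v)).

(** If [p] specialises to [1] at [v], then multiplication by [p] on the free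
    module [A[T]/(f)] specialises to the identity; its determinant lies in
    [(f, p)] and is a constant, so it vanishes at [v]. *)
Lemma specialization_proper p : J p -> ev p <> 1.
Proof.
move=> Jp evp.
pose e := (size f).-1.
have szf : size f = e.+1 by rewrite prednK // size_poly_gt0 monic_neq0.
have e0 : (0 < e)%N.
  rewrite lt0n; apply/eqP => e0.
  have /eqP/size_poly1P[c c0 fc] : size f = 1%N by rewrite szf e0.
  have f1 : f = 1 by move/monicP: (fm); rewrite fc lead_coefC => ->.
  by apply: J1; rewrite -f1.
pose r j := Pdiv.CommonRing.rmodp ('X^j * p) f.
pose q j := Pdiv.CommonRing.rdivp ('X^j * p) f.
have rE j : 'X^j * p = q j * f + r j by exact: Pdiv.RingMonic.rdivp_eq.
have szr j : (size (r j) <= e)%N.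
  by rewrite -ltnS -szf Pdiv.CommonRing.ltn_rmodp monic_neq0.
pose M : 'M_e := \matrix_(j, k) (r j)`_k.
pose MP := map_mx polyC M.
pose w : 'cV[{poly {mpoly K[n]}}]_e := \col_k 'X^k.
have Mw j : (MP *m w) j 0 = r j.
  have -> : r j = \poly_(k < e) (r j)`_k.
    apply/polyP => k; rewrite coef_poly; case: ltnP => // le_ek.
    by rewrite nth_default // (leq_trans (szr j)).
  by rewrite mxE poly_def; apply: eq_bigr => k _; rewrite !mxE mul_polyC.
have Jr j : J (r j).
  have -> : r j = 'X^j * p - q j * f by rewrite rE addrC addKr.
  by apply: (idealB idJ); apply: idealMl.
have Jdet : J (\det M)%:P.
  have : (\adj MP *m (MP *m w)) (Ordinal e0) 0 = (\det MP) * w (Ordinal e0) 0.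
    by rewrite mulmxA mul_adj_mx mul_scalar_mx !mxE.
  rewrite [w _ _]mxE expr0 mulr1 det_map_mx => <-.
  rewrite mxE; apply: (ideal_sum idJ) => j _; rewrite Mw; exact: idealMl.
have evM : map_mx (meval v) M = 1%:M.
  apply/matrixP => j k; rewrite !mxE.
  suff evr : ev (r j) = 'X^j by rewrite -coef_map /= evr coefXn eq_sym.
  have := congr1 (fun h => h : {poly _}) (congr1 (fun h => ev h) (rE j)).
  rewrite rmorphM rmorphD rmorphM /= evp mulr1 map_polyXn => E.
  have evfm : ev f \is monic by exact: monic_map.
  have szf' : size (ev f) = e.+1 by rewrite size_map_poly_id0 ?szf // (monicP fm) rmorph1
    oner_eq0.
  have szr' : (size (ev (r j)) < size (ev f))%N.
    by rewrite szf' ltnS (leq_trans (size_poly _ _)).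
  have := Pdiv.RingMonic.rmodp_addl_mul_small evfm (ev (q j)) szr'.
  by rewrite -E Pdiv.CommonRing.rmodp_small // szf' size_polyXn ltnS.
have := v0 Jdet; rewrite -[X in X = _]/(meval v _) -det_map_mx evM det1.
by move/eqP; rewrite oner_eq0.
Qed.

Lemma lift_zero : exists c, forall p, J p -> (ev p).[c] = 0.
Proof.
pose I q := exists2 p, J p & ev p = q.
have idI : ideal I.
  split; first by exists 0; rewrite ?rmorph0 //; exact: ideal0.
    by move=> _ _ [p Jp <-] [q Jq <-]; exists (p + q); rewrite ?rmorphD //; exact: idealD.
  move=> a _ [p Jp <-]; exists (map_poly (@mpolyC n K) a * p); first exact: idealMl.
  by rewrite rmorphM /=; congr (_ * _); apply/polyP => i; rewrite !coef_map /= mevalC.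
have [|||c cP] := @poly_ideal_root I (ev f) idI.
- by case=> p Jp; exact: specialization_proper.
- by exists f.
- exact/monic_neq0/monic_map.
by exists c => p Jp; apply: cP; exists p.
Qed.

End OneVariable.

Lemma mpoly_nonzero_point n (p : {mpoly K[n]}) : p != 0 -> exists v, p.@[v] != 0.
Proof.
elim: n p => [|n IHn] p p0.
  exists (fun=> 0); rewrite (nvar0_mpolyC p) mevalC.
  by apply: contraNneq p0 => p0; rewrite (nvar0_mpolyC p) p0.
pose q := shear (fun=> 0) p.
have q0 : q != 0.
  by apply: contraNneq p0 => q0; rewrite -(shearK (fun=> 0) p) -/q q0 rmorph0.
have [v /eqP lv] : exists v, (lead_coef q).@[v] != 0 by apply: IHn; rewrite lead_coef_eq0.
have /closed_nonrootP[t rt] : map_poly (meval v) q != 0.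
  by apply/eqP => /polyP/(_ (size q).-1); rewrite coef0 coef_map.
exists (extend_pt (fun j => v j + 0 * t) t).
by rewrite -(shear_eval (fun=> 0)).
Qed.

(** After a shear in a direction where the top form of some element does not
    vanish, that element is monic up to a constant, and the induction on the
    number of variables applies. *)
Lemma weak_nullstellensatz n (I : {mpoly K[n]} -> Prop) :
  ideal I -> ~ I 1 -> has_zero I.
Proof.
elim: n I => [|n IHn] I idI I1.
  exists (fun=> 0) => p Ip; rewrite (nvar0_mpolyC p) mevalC.
  apply/eqP/negPn/negP => p0; apply: (ideal_proper idI (b := ((p@_0)^-1)%:MP) I1 _ Ip).
  by rewrite {1}(nvar0_mpolyC p) -rmorphM divff // rmorph1.
have [[f If f0]|I0] := pselect (exists2 f, I f & f != 0); last first.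
  exists (fun=> 0) => p Ip; apply/eqP/negPn/negP => p0; apply: I0; exists p => //.
  by apply: contraNneq p0 => ->; rewrite meval0.
pose d := (msize f).-1;
  have szf : msize f = d.+1 by rewrite prednK // lt0n msize_poly_eq0.
pose F := pihomog mdeg d f.
have F0 : F != 0.
  have : F@_(mlead f) != 0.
    have dl : mdeg (mlead f) = d by apply/eqP; rewrite -eqSS mlead_deg // szf.
    have ml : (mdeg (mlead f) < d.+1)%N by rewrite dl.
    rewrite /F (pihomogwE _ _ (eq_leq szf)) raddf_sum (bigD1 (BMultinom ml)) /=;
      last exact/eqP.
    rewrite mcoeffZ mcoeffX eqxx mulr1 big1 ?addr0 ?mleadc_eq0 // => m /andP[_ ne].
    by rewrite mcoeffZ mcoeffX -[mlead f]/(val (BMultinom ml)) -(inj_eq val_inj) /= in ne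
      *;
      rewrite (negPf ne) mulr0.
  by apply: contraNneq => ->; rewrite mcoeff0.
have [z] : exists z, (F * 'X_ord_max).@[z] != 0.
  apply: mpoly_nonzero_point; rewrite mulf_neq0 //.
  by apply/eqP => /(congr1 (mcoeff U_(ord_max))); rewrite mcoeffXU eqxx mcoeff0;
    apply/eqP/oner_neq0.
rewrite mevalM mevalXU mulf_eq0 negb_or => /andP[Fz zm].
pose c j := (z ord_max)^-1 * z (lift ord_max j).
have Fc : F.@[extend_pt c 1] != 0.
  have -> : F.@[extend_pt c 1] = F.@[fun i => (z ord_max)^-1 * z i].
    apply: meval_eq => i; rewrite /extend_pt; case: unliftP => [j|] -> //.
    by rewrite mulVf.
  by rewrite (meval_dhomogZ _ _ (pihomogP _ _ _)) mulf_neq0 // expf_neq0 // invr_eq0.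
have [szq coq] := shear_top c (eq_leq szf).
pose J q := I (unshear c q).
have idJ : ideal J.
  split=> [|p q|p q]; rewrite /J ?rmorph0 ?rmorphD ?rmorphM; first exact: ideal0.
    exact: idealD.
  exact: idealMl.
have J1 : ~ J 1 by rewrite /J rmorph1.
pose g := ((F.@[extend_pt c 1])^-1%:MP)%:P * shear c f.
have Jg : J g by apply: idealMl; rewrite // /J shearK.
have gm : g \is monic.
  have gd : g`_d = 1 by rewrite coefCM coq -rmorphM mulVf // rmorph1.
  have szg : (size g <= d.+1)%N by rewrite /g mul_polyC (leq_trans (size_scale_leq _ _)).
  rewrite monicE lead_coefE; have -> : (size g).-1 = d; last by rewrite gd.
  have : (d < size g)%N.
    by rewrite ltnNge; apply/negP => /(nth_default 0); rewrite gd => /eqP;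
      rewrite oner_eq0.
  by move: szg; lia.
have [v vP] : has_zero (fun a => J a%:P).
  apply: IHn; last by rewrite polyC1.
  split; first by rewrite polyC0; exact: ideal0.
    by move=> a b; rewrite polyCD; apply: idealD.
  by move=> a b; rewrite polyCM; apply: idealMl.
have [t tP] := lift_zero idJ J1 Jg gm vP.
exists (extend_pt (fun j => v j + c j * t) t) => p Ip.
by rewrite -shear_eval tP // /J shearK.
Qed.

(** The ideal [Q] of the proof is the contraction of [I A_p] along
    [A[T] -> A_p], [T -> 1/p]; it contains [1 - p T], so it has no zero at a
    point where [p] vanishes. *)
Lemma nullstellensatz n (I : {mpoly K[n]} -> Prop) (p : {mpoly K[n]}) :
  ideal I -> (forall v, (forall q, I q -> q.@[v] = 0) -> p.@[v] = 0) ->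
  exists N, I (p ^+ N).
Proof.
move=> idI pZ.
have [->|p0] := eqVneq p 0; first by exists 1%N; rewrite expr1; exact: ideal0.
pose u : {poly {mpoly K[n]}} := 1 - p *: 'X.
pose Q q := exists M r (s : {poly {mpoly K[n]}}), I r /\ (p ^+ M)%:P * q = r%:P + s * u.
have loc q : exists M r (s : {poly {mpoly K[n]}}), (p ^+ M)%:P * q = r%:P + s * u.
  elim/poly_ind: q => [|q a [M [r [s qE]]]].
    by exists 0%N, 0, 0; rewrite mulr0 mul0r addr0.
  exists M.+1, (r + p ^+ M.+1 * a), (p%:P * s * 'X - r%:P).
  rewrite exprS polyCM mulrDr mulrA -(mulrA p%:P) qE /u -mul_polyC !polyCD !polyCM.
  by ring.
have idQ : ideal Q.
  split.
  - by exists 0%N, 0, 0; rewrite mulr0 mul0r addr0; split=> //; exact: ideal0.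
  - move=> a b [M [r [s [Ir aE]]]] [M' [r' [s' [Ir' bE]]]].
    exists (M + M')%N, (p ^+ M' * r + p ^+ M * r'),
      ((p ^+ M')%:P * s + (p ^+ M)%:P * s').
    split; first by apply: (idealD idI); apply: idealMl.
    rewrite exprD polyCM mulrDr mulrAC aE -mulrA bE !polyCD !polyCM; ring.
  move=> a b [M [r [s [Ir bE]]]]; have [M' [r' [s' aE]]] := loc a.
  exists (M' + M)%N, (r' * r), (r%:P * s' + (p ^+ M')%:P * a * s).
  split; first exact: idealMl.
  rewrite exprD polyCM mulrACA bE mulrDr aE !polyCM; ring.
have [Q1|nQ1] := pselect (Q 1).
  have [M [r [s [Ir E]]]] := Q1; exists M.
  have szu : size u = 2%N.
    by rewrite /u addrC size_polyDl size_polyN size_scale ?size_polyX ?size_poly1.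
  have s0 : s = 0.
    apply/eqP/negPn/negP => s0; have : (size (s * u)%R <= 1)%N.
      by have -> : s * u = (p ^+ M - r)%:P;
        rewrite ?size_polyC_leq1 // polyCB -[X in X - _]mulr1 E; ring.
    have u0 : u != 0 by rewrite -size_poly_eq0 szu.
    by rewrite size_mul // szu addn2 /= ltnS leqn0 size_poly_eq0 (negPf s0).
  by move: E; rewrite s0 mul0r addr0 mulr1 => /polyC_inj ->.
pose J (q : {mpoly K[n.+1]}) := Q (shear (fun=> 0) q).
have [||w wP] := @weak_nullstellensatz n.+1 J.
- split=> [|a b|a b]; rewrite /J ?rmorph0 ?rmorphD ?rmorphM; first exact: ideal0.
    exact: idealD.
  exact: idealMl.
- by rewrite /J rmorph1.
pose v j := w (lift ord_max j); pose t := w ord_max.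
have wE q : J q -> (map_poly (meval v) (shear (fun=> 0) q)).[t] = 0.
  move=> /wP q0; rewrite shear_eval -[RHS]q0; apply: meval_eq => i.
  by rewrite /extend_pt; case: unliftP => [j|] -> //=; rewrite mul0r addr0.
have shw := @shear_unshear_coef n K (fun=> 0).
have vI q : I q -> q.@[v] = 0.
  move=> Iq; have := wE (unshear_coef (fun=> 0) q).
  rewrite shw map_polyC /= hornerC; apply; rewrite /J shw.
  by exists 0%N, q, 0; rewrite mul0r addr0 mul1r.
have := wE (1 - unshear_coef (fun=> 0) p * 'X_ord_max).
have -> : shear (fun=> 0) (1 - unshear_coef (fun=> 0) p * 'X_ord_max) = u.
  rewrite rmorphB rmorphM /= rmorph1 shw shearX /shear_var unlift_none.
  by rewrite mul_polyC.
have Ju : J (1 - unshear_coef (fun=> 0) p * 'X_ord_max).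
  rewrite /J rmorphB rmorphM /= rmorph1 shw shearX /shear_var unlift_none.
  exists 0%N, 0, 1; split; first exact: ideal0.
  by rewrite mul1r mul1r add0r /u mul_polyC.
move=> /(_ Ju);
  rewrite /u rmorphB /= rmorph1 -mul_polyC rmorphM /= map_polyC /= map_polyX.
by rewrite !hornerE pZ // mul0r subr0 => /eqP; rewrite oner_eq0.
Qed.

End Nullstellensatz.

(** * Linear algebra modulo a subspace *)

Definition subspace (K : fieldType) (V : lmodType K) (P : V -> Prop) :=
  [/\ P 0, forall u v, P u -> P v -> P (u + v) & forall a v, P v -> P (a *: v)].

Section Subspace.
Variables (K : fieldType) (V : lmodType K) (P : V -> Prop).
Hypothesis sP : subspace P.

Lemma subspace_lin (I : Type) (r : seq I) (Q : pred I) (c : I -> K) (F : I -> V) :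
  (forall i, Q i -> P (F i)) -> P (\sum_(i <- r | Q i) c i *: F i).
Proof.
case: sP => P0 PD PZ PF; apply: big_ind => // i Qi; exact/PZ/PF.
Qed.

(** The Steinitz bound, relative to [P]. *)
Lemma leq_card_indep (I J : finType) (u : I -> V) (v : J -> V) :
  (forall i, exists c : J -> K, P (u i - \sum_j c j *: v j)) ->
  (forall c : I -> K, P (\sum_i c i *: u i) -> forall i, c i = 0) ->
  (#|I| <= #|J|)%N.
Proof.
move=> span indep; have [c cP] := choice span.
rewrite leqNgt; apply/negP => ltJI.
pose C : 'M[K]_(#|I|, #|J|) := \matrix_(i, j) c (enum_val i) (enum_val j).
have /rowV0Pn[x /sub_kermxP xC x0] : kermx C != 0.
  rewrite kermx_eq0 /row_free; apply: contraTneq ltJI => rC.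
  by rewrite -leqNgt -rC rank_leq_col.
have /rV0Pn[i xi] := x0; move/eqP: xi; apply.
pose a i := x 0 (enum_rank i).
have -> : x 0 i = a (enum_val i) by rewrite /a enum_valK.
apply: (indep a).
have -> : \sum_i a i *: u i = \sum_i a i *: (u i - \sum_j c i j *: v j).
  under [RHS]eq_bigr do rewrite scalerBr.
  rewrite sumrB -[LHS]subr0; congr (_ - _); apply/esym.
  under eq_bigr do rewrite scaler_sumr.
  (* the coefficients were chosen in the left kernel of [C] *)
  rewrite exchange_big big1 //= => j _.
  under eq_bigr do rewrite scalerA.
  rewrite -scaler_suml (_ : \sum_i _ = 0) ?scale0r //.
  have := congr1 (fun M : 'rV_#|J| => M 0 (enum_rank j)) xC.
  rewrite !mxE => xCj; rewrite -[RHS]xCj (reindex (@enum_val I predT)) /=; last first.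
    by exists enum_rank => ? _; rewrite ?enum_valK ?enum_rankK.
  by apply: eq_bigr => l _; rewrite /a enum_valK mxE enum_rankK.
by apply: subspace_lin.
Qed.

End Subspace.

(** * Orders of vanishing and powers of an ideal *)

Section Jets.
Variables (n : nat) (K : fieldType).
Implicit Types (p q : {mpoly K[n]}) (b : 'I_n -> K) (a m : 'X_{1..n}).

Definition translate b p := p \mPo [tuple 'X_i + (b i)%:MP | i < n].

HB.instance Definition _ b := GRing.RMorphism.copy (translate b)
  (comp_mpoly [tuple 'X_i + (b i)%:MP | i < n]).

Lemma translateX b i : translate b 'X_i = 'X_i + (b i)%:MP.
Proof. by rewrite /translate comp_mpolyXU -tnth_nth tnth_mktuple. Qed.

Lemma translateC b c : translate b c%:MP = c%:MP.
Proof. exact: comp_mpolyC. Qed.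

Lemma translateZ b c p : translate b (c *: p) = c *: translate b p.
Proof. exact: comp_mpolyZ. Qed.

Lemma translateK b : cancel (translate (fun i => - b i)) (translate b).
Proof.
apply: (mpoly_rmorph_ext (f := translate b \o translate (fun i => - b i)) (g := idfun))
  => [c|i] /=.
  by rewrite !translateC.
by rewrite translateX rmorphD /= translateX translateC -addrA -rmorphD subrr rmorph0
  addr0.
Qed.

Lemma translate0 b p : (translate b p)@_0 = p.@[b].
Proof.
apply: (mpoly_rmorph_ext (f := mcoeff 0%MM \o translate b) (g := meval b)) => [c|i] /=.
  by rewrite translateC mcoeffC eqxx mulr1 mevalC.
by rewrite translateX mevalXU mcoeffD mcoeffC mcoeffX mnm1_eq0 eqxx mulr1 add0r.
Qed.

(** Read on the Taylor coefficients of [p] at [b]. *)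
Definition vanish_order b N p := forall m, (mdeg m < N)%N -> (translate b p)@_m = 0.

Lemma vanish_orderM b N M p q :
  vanish_order b N p -> vanish_order b M q -> vanish_order b (N + M) (p * q).
Proof.
move=> pN qM m mNM; rewrite rmorphM mcoeffM big1 // => -[m1 m2] /= /eqP mE.
have [lt1|ge1] := ltnP (mdeg m1) N; first by rewrite pN ?mul0r.
by rewrite qM ?mulr0 //; move: mNM (congr1 mdeg mE) ge1; rewrite mdegD; lia.
Qed.

Lemma vanish_order0 b p : vanish_order b 0 p.
Proof. by []. Qed.

Lemma vanish_orderW b N M p : (M <= N)%N -> vanish_order b N p -> vanish_order b M p.
Proof. by move=> le_MN pN m mM; apply: pN; apply: leq_trans le_MN. Qed.

Lemma vanish_order_ideal b N : ideal (vanish_order b N).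
Proof.
split=> [m _|p q pN qN m mN|p q qN].
- by rewrite rmorph0 mcoeff0.
- by rewrite rmorphD mcoeffD pN ?qN ?addr0.
exact: (@vanish_orderM b 0 N).
Qed.

Lemma vanish_order1 b p : p.@[b] = 0 -> vanish_order b 1 p.
Proof. by move=> pb m; rewrite ltnS leqn0 mdeg_eq0 => /eqP->; rewrite translate0. Qed.

Lemma vanish_orderX b N p e : vanish_order b N p -> vanish_order b (N * e) (p ^+ e).
Proof.
by move=> pN; elim: e => [|e IHe]; rewrite ?muln0 // mulnS exprS; apply: vanish_orderM.
Qed.

Lemma ideal_subspace (I : {mpoly K[n]} -> Prop) : ideal I -> subspace I.
Proof.
by move=> idI; split=> [||c p Ip]; [exact: ideal0 | exact: idealD | rewrite -mul_mpolyC;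
  exact: idealMl].
Qed.

(** If [l] is [1] at one point and [0] at another, then [1 - (1 - l^N)^N] has
    these values there up to order [N]. *)
Lemma vanish_order_idempotent (T : eqType) (R : seq T) (pt : T -> 'I_n -> K) N :
  {in R &, forall r s, r != s -> exists i, pt r i != pt s i} ->
  exists e : T -> {mpoly K[n]}, forall r, r \in R ->
    vanish_order (pt r) N (e r - 1) /\
    forall s, s \in R -> r != s -> vanish_order (pt s) N (e r).
Proof.
move=> sep.
have /choice[u uP] (x : T * T) : exists u : {mpoly K[n]}, x.1 \in R -> x.2 \in R -> x.1
  != x.2 ->
    vanish_order (pt x.1) N (1 - u) /\ vanish_order (pt x.2) N u.
  have [xR|] := boolP [&& x.1 \in R, x.2 \in R & x.1 != x.2]; last first.
    by move=> xR; exists 0 => x1 x2 x12; case/negP: xR; rewrite x1 x2.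
  have /and3P[x1 x2 x12] := xR; have [i ni] := sep _ _ x1 x2 x12.
  pose l : {mpoly K[n]} := (pt x.1 i - pt x.2 i)^-1 *: ('X_i - (pt x.2 i)%:MP).
  have l1 : vanish_order (pt x.1) 1 (1 - l).
    apply: vanish_order1; rewrite mevalB meval1 mevalZ mevalB mevalXU mevalC.
    by rewrite mulVf ?subrr // subr_eq0.
  have l2 : vanish_order (pt x.2) 1 l.
    by apply: vanish_order1; rewrite mevalZ mevalB mevalXU mevalC subrr mulr0.
  have pow c p : vanish_order c 1 p -> vanish_order c N (p ^+ N).
    by move=> p1; rewrite -{1}(mul1n N); apply: vanish_orderX.
  have diff c M p : vanish_order c M (1 - p) -> vanish_order c M (1 - p ^+ N).
    rewrite -{2}(expr1n _ N) subrXX => p1; exact: (idealMr (vanish_order_ideal _ _)) p1.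
  exists (1 - (1 - l ^+ N) ^+ N) => _ _ _; split.
    by rewrite subKr; apply/pow/diff.
  by apply: diff; rewrite subKr; apply: pow.
exists (fun r => \prod_(s <- R | s != r) u (r, s)) => r rR; split.
  rewrite big_seq_cond;
    apply: (big_ind (fun p => vanish_order (pt r) N (p - 1))) => [|p q|s].
  - by rewrite subrr; exact: ideal0 (vanish_order_ideal _ _).
  - have -> : p * q - 1 = p * (q - 1) + (p - 1) by ring.
    by move=> pN qN; apply: (idealD (vanish_order_ideal _ _)) => //;
      apply: (idealMl (vanish_order_ideal _ _)).
  - move=> /andP[sR sr]; rewrite -opprB; apply: (idealN (vanish_order_ideal _ _)).
    by have [] := uP (r, s) rR sR; rewrite // eq_sym.
move=> s sR rs; rewrite (big_rem s) // eq_sym rs.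
apply: (idealMr (vanish_order_ideal _ _)).
by have [] := uP (r, s) rR sR.
Qed.

End Jets.

(** * Weighted powers of an ideal with finitely many zeros *)

Section WeightedPowers.
Variables (n : nat) (K : fieldType) (f : 'I_n -> {mpoly K[n]}) (k : 'I_n -> nat).
Implicit Types (p q r : {mpoly K[n]}) (a : 'X_{1..n}).

Definition fpow a : {mpoly K[n]} := \prod_i f i ^+ a i.

Definition wt a := (\sum_i k i * a i)%N.

Lemma fpowD a a' : fpow (a + a') = fpow a * fpow a'.
Proof. by rewrite -big_split /=; apply: eq_bigr => i _; rewrite mnmDE exprD. Qed.

Lemma fpow0 : fpow 0%MM = 1.
Proof. by rewrite /fpow big1 // => i _; rewrite mnm0E expr0. Qed.

Lemma wtD a a' : wt (a + a') = (wt a + wt a')%N.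
Proof. by rewrite -big_split /=; apply: eq_bigr => i _; rewrite mnmDE mulnDr. Qed.

(** These ideals play the part of the powers of [(f_1, ..., f_n)]; the weights
    [k i] are the degrees, so that a product of weight [w] has degree at most
    [w] even when the degrees differ. *)
Definition wpow w p := exists s : seq ('X_{1..n} * {mpoly K[n]}),
  (forall x, x \in s -> (w <= wt x.1)%N) /\ p = \sum_(x <- s) fpow x.1 * x.2.

Lemma wpow_gen w a q : (w <= wt a)%N -> wpow w (fpow a * q).
Proof.
move=> wa; exists [:: (a, q)]; split; last by rewrite big_seq1.
by move=> x; rewrite inE => /eqP->.
Qed.

Lemma wpow_ind w (P : {mpoly K[n]} -> Prop) :
  P 0 -> (forall p q, P p -> P q -> P (p + q)) ->
  (forall a q, (w <= wt a)%N -> P (fpow a * q)) -> forall p, wpow w p -> P p.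
Proof.
move=> P0 PD Pg p [s [sw ->]]; rewrite big_seq; apply: big_ind => // x xs.
exact/Pg/sw.
Qed.

Lemma wpow_ideal w : ideal (wpow w).
Proof.
split; first by exists [::]; rewrite big_nil.
  move=> p q [s [sw ->]] [t [tw ->]]; exists (s ++ t); rewrite big_cat; split=> // x.
  by rewrite mem_cat => /orP[/sw|/tw].
move=> p q [s [sw ->]]; exists [seq (x.1, p * x.2) | x <- s]; split.
  by move=> _ /mapP[x xs ->] /=; apply: sw.
by rewrite big_map mulr_sumr; apply: eq_bigr => x _; rewrite mulrCA.
Qed.

Lemma wpowM w a p : wpow w p -> wpow (wt a + w) (fpow a * p).
Proof.
move: p; apply: wpow_ind => [|p q|a' q wa'].
- by rewrite mulr0; exact: ideal0 (wpow_ideal _).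
- by rewrite mulrDr => Ip Iq; apply: (idealD (wpow_ideal _)).
by rewrite mulrA -fpowD; apply: wpow_gen; rewrite wtD leq_add2l.
Qed.

Hypothesis k_gt0 : forall i, (0 < k i)%N.

Definition kmax := (\max_i k i)%N.

Lemma leq_k_kmax i : (k i <= kmax)%N.
Proof. exact: leq_bigmax. Qed.

Lemma wt_leq_mdeg a : (wt a <= kmax * mdeg a)%N.
Proof.
by rewrite mdegE big_distrr /=; apply: leq_sum => i _; rewrite leq_mul2r leq_k_kmax orbT.
Qed.

Lemma leq_mnm_wt a i : (a i <= wt a)%N.
Proof.
by rewrite /wt (bigD1 i) //= (leq_trans _ (leq_addr _ _)) // leq_pmull.
Qed.

Lemma fpow_vanish b a : (forall i, (f i).@[b] = 0) -> vanish_order b (mdeg a) (fpow a).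
Proof.
move=> fb; rewrite mdegE /fpow; apply: (big_ind2 (fun e p => vanish_order b e p)).
- exact: vanish_order0.
- by move=> *; apply: vanish_orderM.
by move=> i _; rewrite -{1}(mul1n (a i)); apply/vanish_orderX/vanish_order1.
Qed.

(** A consequence of the Nullstellensatz when the [f i] have finitely many
    common zeros. *)
Variable C : nat.
Hypothesis finite_codim : forall q, exists2 r, (msize r <= C)%N & wpow 1 (q - r).

(** If [l(f)] belonged to [wpow w] near the zero [b], then the products [f^a]
    divisible by one [f^g] taken from [l] would be combinations of the others
    and of products of larger weight. The jets of order [N] at [b], a space of
    dimension of order [N^n], would be spanned by the remaining [f^a], times
    finitely many monomials; but an exponent not divisible by [g] has a
    component smaller than [w], so there are only [O(N^(n-1))] of them. *)
Lemma analytic_independence w : (0 < n)%N ->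
  exists N, forall b, (forall i, (f i).@[b] = 0) -> forall l : {mpoly K[n]},
  (forall a, a \in msupp l -> (wt a < w)%N) -> forall j, wpow w j ->
  vanish_order b N (\sum_(a <- msupp l) l@_a *: fpow a - j) -> l = 0.
Proof.
move=> n0.
pose t := #|{: 'X_{1..n < C}}|.
(* chosen so that [M ^ n] jets outnumber the index type [T] below *)
pose M := (n * w * (kmax * n) ^ n.-1 * t).+1.
pose N := (n * M)%N.
exists N => b fb l lw j Jj lj; apply/eqP/negPn/negP => l0.
pose L := (kmax * N)%N.
pose P := vanish_order b N.
have sP : subspace P by exact/ideal_subspace/vanish_order_ideal.
(* the least weight in [l], and the largest exponent of that weight *)
have [g [gl gmin gmax]] : exists g, [/\ g \in msupp l,
    forall a, a \in msupp l -> (wt g <= wt a)%N &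
    forall a, a \in msupp l -> wt a = wt g -> (a <= g)%O].
  have exw : exists w, has (fun a => wt a == w) (msupp l).
    by exists (wt (mlead l)); apply/hasP; exists (mlead l); rewrite // mlead_supp.
  have [w0 /hasP[a0 a0l /eqP a0w] wmin] := ex_minnP exw.
  pose s := [seq a <- msupp l | wt a == w0].
  have s0 : a0 \in s by rewrite mem_filter a0w eqxx.
  have [g gs gmax] : exists2 g, g \in s & forall a, a \in s -> (a <= g)%O.
    have : s != [::] by apply: contraTneq s0 => ->.
    elim: (s) => // a s' IHs _.
    have [->|s'0] := eqVneq s' [::].
      by exists a; rewrite ?mem_head // => a'; rewrite inE => /eqP->.
    have [g gs' gmax] := IHs s'0.
    have [le_ag|/ltW le_ga] := leP a g.
      exists g; rewrite ?inE ?gs' ?orbT // => a'; rewrite inE => /orP[/eqP->//|/gmax//].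
    exists a; rewrite ?mem_head // => a'; rewrite inE => /orP[/eqP->//|/gmax].
    by move/le_trans; apply.
  move: gs; rewrite mem_filter => /andP[/eqP gw gl].
  exists g; split=> // [a al|a al aw].
    by rewrite gw; apply: wmin; apply/hasP; exists a.
  by apply: gmax; rewrite mem_filter al aw gw eqxx.
pose T := ('I_n * 'I_w * {ffun 'I_n.-1 -> 'I_L} * 'X_{1..n < C})%type.
pose expo (x : 'I_n * 'I_w * {ffun 'I_n.-1 -> 'I_L}) : 'X_{1..n} :=
  [multinom if unlift x.1.1 i is Some i' then (x.2 i' : nat) else (x.1.2 : nat) | i < n].
pose v (x : T) := fpow (expo x.1) * 'X_[x.2].
pose good p := exists c : T -> K, P (p - \sum_x c x *: v x).
have goodP p : P p -> good p.
  by move=> Pp; exists (fun=> 0); rewrite big1 ?subr0 // => x _; rewrite scale0r.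
have good0 : good 0 by apply: goodP; case: sP.
have goodD p q : good p -> good q -> good (p + q).
  move=> [c cP] [d dP]; exists (fun x => c x + d x).
  under eq_bigr do rewrite scalerDl.
  rewrite big_split /= opprD addrACA; by case: sP => _ PD _; apply: PD.
have goodZ c p : good p -> good (c *: p).
  move=> [d dP]; exists (fun x => c * d x).
  under eq_bigr do rewrite -scalerA.
  by rewrite -scaler_sumr -scalerBr; case: sP => _ _; apply.
have good_lin (I : eqType) (s : seq I) (Q : pred I) c (F : I -> {mpoly K[n]}) :
    (forall i, i \in s -> Q i -> good (F i)) -> good (\sum_(i <- s | Q i) c i *: F i).
  move=> gF; rewrite big_seq_cond; apply: big_ind => // i /andP[si Qi]; exact/goodZ/gF.
have high a q : (L <= wt a)%N -> good (fpow a * q).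
  move=> La; apply/goodP/(idealMr (vanish_order_ideal _ _)).
  apply: (vanish_orderW _ (fpow_vanish fb)).
  have km : (0 < kmax)%N by apply: leq_trans (leq_k_kmax (Ordinal n0)).
  by rewrite -(leq_pmul2l km) (leq_trans La) ?wt_leq_mdeg.
have goodg : forall d a q, (L - wt a <= d)%N -> good (fpow a * q).
  elim=> [|d IHd] a; first by move=> q; rewrite leqn0 subn_eq0; apply: high.
  have step a' q' : (wt a < wt a')%N -> (L - wt a <= d.+1)%N -> good (fpow a' * q').
    move=> aa' ad; have [/high//|La] := leqP L (wt a'); apply: IHd; lia.
  elim/(well_founded_induction (@ltom_wf n)): a step => a IHa step q ad.
  have wstep a' p : (wt a < wt a')%N -> good (fpow a' * p) by move/step; apply.
  have wstepJ a' u p : (wt a < wt a' + u)%N -> wpow u p -> good (fpow a' * p).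
    move=> au /(wpowM a'); move: (fpow a' * p); apply: wpow_ind => // c q' uc.
    by apply: (wstep); apply: leq_trans uc.
  have [r szr Jr] := finite_codim q.
  have -> : q = r + (q - r) by rewrite addrC subrK.
  rewrite mulrDr; apply: (goodD); last by apply: (wstepJ) Jr; rewrite addn1.
  rewrite (mpolyE r) mulr_sumr; under eq_bigr do rewrite -scalerAr.
  apply: (good_lin) => m mr _.
  have mC : (mdeg m < C)%N by apply: leq_trans szr; apply: msize_mdeg_lt.
  have [ga|] := boolP (g <= a)%MM; last first.
    move=> /mnm_lepP nga; have [i agi] : exists i, (a i < g i)%N.
      apply: contrapT => noi; apply: nga => i; rewrite leqNgt; apply/negP => agi.
      by apply: noi; exists i.
    have [aL|La] := ltnP (wt a) L; last exact: high.
    have aiL i' : (a i' < L)%N by apply: leq_ltn_trans (leq_mnm_wt a i') aL.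
    have aiw : (a i < w)%N.
      by apply: leq_trans agi _; apply: leq_trans (leq_mnm_wt g i) _; apply/ltnW/lw.
    pose x : T := (i, Ordinal aiw, [ffun i' => Ordinal (aiL (lift i i'))], BMultinom mC).
    have vx : v x = fpow a * 'X_[m].
      rewrite /v /=; congr (fpow _ * _); apply/mnmP => i'; rewrite mnmE /=.
      by case: unliftP => [i''|] -> //; rewrite ffunE.
    exists (fun y => (y == x)%:R); rewrite -vx (bigD1 x) //= eqxx scale1r big1.
      by rewrite addr0 subrr; case: sP.
    by move=> y /negPf ->; rewrite scale0r.
  pose h := (a - g)%MM; have aE : a = (h + g)%MM by rewrite /h submK.
  (* the leading product is replaced by the other products of [l] *)
  have gE : fpow g = - (l@_g)^-1 *: (\sum_(c <- msupp l | c != g) l@_c *: fpow c)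
                     + (l@_g)^-1 *: j + (l@_g)^-1 *: (\sum_(c <- msupp l) l@_c *: fpow c
                       - j).
    rewrite (bigD1_seq g) //= ?msupp_uniq //.
    rewrite scaleNr -scalerN -!scalerDr -[LHS]scale1r.
    rewrite -[X in X *: _ = _](mulVf (_ : l@_g != 0)) -?mcoeff_msupp // -scalerA.
    congr (_ *: _); move: (l@_g *: fpow g) (\sum_(c <- _ | _) _) => x y; ring.
  rewrite aE fpowD gE -mulrA [_ * 'X_[m]]mulrC mulrCA.
  rewrite !mulrDr; apply: (goodD); [apply: (goodD)|].
  - rewrite mulrA -scalerAr; apply: (goodZ); rewrite mulr_sumr.
    under eq_bigr do rewrite -scalerAr.
    apply: (good_lin) => c cl cg.
    have -> : 'X_[m] * fpow h * fpow c = fpow (h + c) * 'X_[m] by rewrite fpowD; ring.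
    have := gmin _ cl; rewrite leq_eqVlt => /orP[/eqP wgc|wgc]; last first.
      by apply: (wstep); rewrite aE !wtD ltn_add2l.
    have wE : wt (h + c) = wt a by rewrite aE !wtD wgc.
    apply: (IHa); rewrite ?wE //.
    by rewrite aE ltmc_add2r lt_neqAle cg; apply: gmax.
  - rewrite mulrA -scalerAr; apply: (goodZ).
    have -> : 'X_[m] * fpow h * j = fpow h * ('X_[m] * j) by ring.
    apply: (@wstepJ _ w); last exact: (idealMl (wpow_ideal _)).
    by rewrite aE wtD ltn_add2l; apply: lw.
  rewrite mulrA -scalerAr; apply/goodZ/goodP.
  exact: (idealMl (vanish_order_ideal _ _)).
have allgood p : good p by rewrite -[p]mul1r -fpow0; apply: (goodg L); rewrite leq_subr.
pose jet (x : {ffun 'I_n -> 'I_M}) : 'X_{1..n} := [multinom (x i : nat) | i < n].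
have : (#|{ffun 'I_n -> 'I_M}| <= #|{: T}|)%N.
  apply: (leq_card_indep sP (u := fun x => translate (fun i => - b i) 'X_[jet x]) (v :=
    v)).
    by move=> x; exact: allgood.
  move=> c cP x; have xN : (mdeg (jet x) < N)%N.
    rewrite mdegE; apply: (@leq_ltn_trans (\sum_(i < n) M.-1)).
      by apply: leq_sum => i _; rewrite mnmE -ltnS.
    by rewrite sum_nat_const card_ord ltn_pmul2l.
  have := cP _ xN;
    rewrite (rmorph_sum (translate b)) (raddf_sum (mcoeff (jet x))) (bigD1 x) //=.
  rewrite translateZ translateK mcoeffZ mcoeffX eqxx mulr1 big1 ?addr0 // => y yx.
  rewrite translateZ translateK mcoeffZ mcoeffX (_ : _ == _ = false) ?mulr0 //.
  apply: contraNF yx => /eqP/mnmP yx; apply/eqP/ffunP => i; apply/val_inj.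
  by have := yx i; rewrite !mnmE.
rewrite !card_prod !card_ffun !card_ord -/t.
rewrite leqNgt => /negP; apply.
have -> : (M ^ n = M * M ^ n.-1)%N by rewrite -expnS prednK.
rewrite !expnMn.
have -> : (n * w * (kmax ^ n.-1 * (n ^ n.-1 * M ^ n.-1)) * t
  = n * w * (kmax * n) ^ n.-1 * t * M ^ n.-1)%N by rewrite expnMn; lia.
by rewrite ltn_pmul2r // expn_gt0.
Qed.
End WeightedPowers.

(** * Bezout's bound is strict when there is a zero at infinity *)

Section SupportBound.
Variables (n : nat) (K : fieldType) (mu : 'X_{1..n} -> nat).
Hypotheses (mu0 : mu 0%MM = 0%N) (muD : forall a b, mu (a + b)%MM = (mu a + mu b)%N).

Definition supp_le d (p : {mpoly K[n]}) := forall m, m \in msupp p -> (mu m <= d)%N.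

Lemma supp_leM d e p q : supp_le d p -> supp_le e q -> supp_le (d + e) (p * q).
Proof.
move=> pd qe m /msuppM_le/allpairsP[[m1 m2] /= [m1p m2q ->]].
by rewrite muD leq_add ?pd ?qe.
Qed.

Lemma supp_le_fpow (f : 'I_n -> {mpoly K[n]}) (d : 'I_n -> nat) (a : 'X_{1..n}) :
  (forall i, supp_le (d i) (f i)) -> supp_le (\sum_i d i * a i) (fpow f a).
Proof.
move=> fd; apply: (big_ind2 (fun e p => supp_le e p)) => [m|e1 p1 e2 p2|i _].
- by rewrite msupp1 inE => /eqP->; rewrite mu0.
- by move=> *; apply: supp_leM.
elim: (a i) => [|e IHe]; first by rewrite expr0 muln0 => m; rewrite msupp1 inE => /eqP->;
  rewrite mu0.
by rewrite mulnS exprS; apply: supp_leM.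
Qed.

End SupportBound.

Section TooManyZeros.
Variables (n : nat) (K : fieldType) (f : 'I_n -> {mpoly K[n]}) (k : 'I_n -> nat).
Variables (j : 'I_n) (C : nat) (pt : 'X_{1..n} -> 'I_n -> K).
Hypothesis k_gt0 : forall i, (0 < k i)%N.
Hypothesis finite_codim : forall q : {mpoly K[n]}, exists2 r, (msize r <= C)%N & wpow f k
  1 (q - r).
Hypothesis deg_f : forall i, supp_le (@mdeg n) (k i) (f i).
Hypothesis degj_f : forall i, supp_le (fun m => m j) (k i).-1 (f i).

Implicit Types (p q r s : {mpoly K[n]}) (a m : 'X_{1..n}).

Local Notation wt := (wt k).
Local Notation kmax := (kmax k).

(** The degree of [f^a] in [x_j] falls short of the weight of [a] by at least
    the number of factors. Reducing modulo products of large weight thus leaves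
    no exponent with a component [j] close to the maximal degree. *)
Lemma reduce_support v q : exists2 r,
  (forall m, m \in msupp r -> (mdeg m < kmax * v + C)%N /\ (m j + v <= kmax * v + C)%N) &
  wpow f k (kmax * v) (q - r).
Proof.
pose w := (kmax * v)%N.
pose low r := forall m, m \in msupp r -> (mdeg m < w + C)%N /\ (m j + v <= w + C)%N.
pose good p := exists2 r, low r & wpow f k w (p - r).
have goodD p q' : good p -> good q' -> good (p + q').
  move=> [r lr Jr] [s ls Js]; exists (r + s).
    by move=> m /msuppD_le; rewrite mem_cat => /orP[/lr|/ls].
  by rewrite opprD addrACA; apply: (idealD (wpow_ideal _ _ _)).
have good0 : good 0.
  exists 0; first by move=> m; rewrite msupp0.
  by rewrite subrr; exact: ideal0 (wpow_ideal _ _ _).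
have high a p : (w <= wt a)%N -> good (fpow f a * p).
  move=> wa; exists 0; first by move=> m; rewrite msupp0.
  by rewrite subr0; apply: wpow_gen.
suff goodg d a p : (w - wt a <= d)%N -> good (fpow f a * p).
  by rewrite -[q]mul1r -(fpow0 f); apply: (goodg w); rewrite leq_subr.
elim: d a p => [|d IHd] a p ad; first by apply: high; rewrite -subn_eq0 -leqn0.
have [/high//|aw] := leqP w (wt a).
have [r szr Jr] := finite_codim p.
rewrite -(subrK r p) mulrDr; apply: (goodD).
  have := wpowM a Jr; move: (fpow f a * (p - r)); apply: wpow_ind => // c q' ac.
  by apply: IHd; move: ac ad aw; lia.
exists (fpow f a * r); last by rewrite subrr; exact: ideal0 (wpow_ideal _ _ _).
have szm m : m \in msupp r -> (mdeg m < C)%N.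
  by move=> /msize_mdeg_lt mr; apply: leq_trans szr.
have [r0|r0] := eqVneq r 0; first by move=> m; rewrite r0 mulr0 msupp0.
have C0 : (0 < C)%N by apply: leq_trans szr; rewrite lt0n msize_poly_eq0.
have szr' : supp_le (@mdeg n) C.-1 r by move=> m /szm; lia.
have szrj : supp_le (fun m => m j) C.-1 r.
  by move=> m /szr'; apply: leq_trans; rewrite mdegE (bigD1 j) //= leq_addr.
have degD : forall a b : 'X_{1..n}, mdeg (a + b)%MM = (mdeg a + mdeg b)%N by exact: mdegD.
have degjD : forall a b : 'X_{1..n}, ((a + b)%MM j = a j + b j)%N by move=> *;
  rewrite mnmDE.
have B1 := supp_leM degD (supp_le_fpow (@mdeg0 n) degD (a := a) deg_f) szr'.
have B2 := supp_leM degjD (supp_le_fpow (mu := fun m => m j) (mnm0E j) degjD (a := a)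
  degj_f) szrj.
have wtB : (wt a <= kmax * mdeg a)%N by exact: wt_leq_mdeg.
have sumj : (\sum_i (k i).-1 * a i + mdeg a = wt a)%N.
  rewrite mdegE -big_split /=; apply: eq_bigr => i _.
  by have := k_gt0 i; case: (k i) => // k' _; rewrite mulSn addnC.
move=> m mr; split.
  by move: (B1 m mr) aw; rewrite -/(wt a); move: C0; lia.
apply: (@leq_trans (wt a - mdeg a + C.-1 + v)).
  by move: (B2 m mr) sumj; lia.
have [vd|dv] := leqP v (mdeg a).
  by move: sumj aw C0; lia.
have : ((kmax - 1) * mdeg a <= (kmax - 1) * v)%N by rewrite leq_mul2l ltnW ?orbT.
have km : (0 < kmax)%N by apply: leq_trans (leq_k_kmax k j).
rewrite !mulnBl !mul1n.
have : (v <= kmax * v)%N by rewrite leq_pmull.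
rewrite /w; lia.
Qed.

Hypothesis f_pt : forall (r : 'X_{1..n}) i, (f i).@[pt r] = 0.
Hypothesis pt_sep : forall r s : 'X_{1..n}, (forall i, r i < k i)%N ->
  (forall i, s i < k i)%N -> r != s -> exists i, pt r i != pt s i.

(** Division of the exponent [x] by the [k i] gives a product [f^(x / k)] and,
    through the remainder, one of the points; the products, each multiplied by
    a function that is [1] near its point and [0] near the other ones, are
    independent modulo [wpow] because they are so at each point. *)
Lemma leq_card_exponents v (L := (kmax * v + C)%N) :
  (#|[set x : {ffun 'I_n -> 'I_L} | \sum_i x i < kmax * v]| <=
   #|[set x : {ffun 'I_n -> 'I_L} | (\sum_i x i < L) && (x j + v <= L)]|)%N.
Proof.
have n0 : (0 < n)%N by apply: leq_ltn_trans (ltn_ord j).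
set w := (kmax * v)%N.
pose mon (x : {ffun 'I_n -> 'I_L}) : 'X_{1..n} := [multinom (x i : nat) | i < n].
pose quo (x : {ffun 'I_n -> 'I_L}) : 'X_{1..n} := [multinom (x i %/ k i)%N | i < n].
pose res (x : {ffun 'I_n -> 'I_L}) : 'X_{1..n} := [multinom (x i %% k i)%N | i < n].
have mon_inj : injective mon.
  by move=> x y /mnmP xy; apply/ffunP => i; apply/val_inj; have := xy i; rewrite !mnmE.
have quo_res_inj x y : quo x = quo y -> res x = res y -> x = y.
  move=> /mnmP q /mnmP r; apply/ffunP => i; apply/val_inj => /=.
  have := q i; have := r i; rewrite !mnmE => ri qi.
  by rewrite (divn_eq (x i) (k i)) (divn_eq (y i) (k i)) qi ri.
have [N NP] := analytic_independence k_gt0 finite_codim w n0.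
have [|e eP] := @vanish_order_idempotent _ _ _ [seq res x | x : {ffun 'I_n -> 'I_L}] pt N.
  move=> _ _ /mapP[x _ ->] /mapP[y _ ->]; apply: pt_sep => i; by rewrite mnmE ltn_pmod.
have {}eP x : vanish_order (pt (res x)) N (e (res x) - 1) /\
    forall y, res x != res y -> vanish_order (pt (res y)) N (e (res x)).
  have resR y : res y \in [seq res x | x : {ffun 'I_n -> 'I_L}].
    by apply/mapP; exists y; rewrite ?mem_enum.
  by have [xP yP] := eP _ (resR x); split=> // y; apply: yP.
set A := [set x | _]; set B := [set x | _].
pose I := {x | x \in A}; pose J := {x | x \in B}.
have cardI : #|{: I}| = #|A| by rewrite card_sig; apply: eq_card => x.
have cardJ : #|{: J}| = #|B| by rewrite card_sig; apply: eq_card => x.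
rewrite -cardI -cardJ.
apply: (leq_card_indep (ideal_subspace (wpow_ideal f k w))
  (u := fun x : I => fpow f (quo (val x)) * e (res (val x)))
  (v := fun x : J => 'X_[mon (val x)])) => [x|c cP x].
  have [r rB Jr] := reduce_support v (fpow f (quo (val x)) * e (res (val x))).
  exists (fun y => r@_(mon (val y))).
  suff -> : \sum_(y : J) r@_(mon (val y)) *: 'X_[mon (val y)] = r :> {mpoly K[n]} by [].
  apply/mpolyP => m; rewrite raddf_sum /=.
  have [mr|mr] := boolP (m \in msupp r); last first.
    rewrite (memN_msupp_eq0 mr) big1 // => y _; rewrite mcoeffZ mcoeffX.
    by case: eqP => [ym|]; rewrite ?mulr0 // mulr1 ym memN_msupp_eq0.
  have [md mj] := rB _ mr.
  have mL i : (m i < L)%N.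
    by apply: leq_ltn_trans md; rewrite mdegE (bigD1 i) //= leq_addr.
  pose y0 : {ffun 'I_n -> 'I_L} := [ffun i => Ordinal (mL i)].
  have y0m : mon y0 = m by apply/mnmP => i; rewrite mnmE ffunE.
  have y0B : y0 \in B.
    rewrite inE ffunE /= mj andbT; move: md; rewrite mdegE.
    by under [X in _ -> (X < _)%N]eq_bigr do rewrite ffunE.
  rewrite (bigD1 (exist _ y0 y0B : J)) //= mcoeffZ mcoeffX y0m eqxx mulr1 big1 ?addr0 //
    => y.
  rewrite -val_eqE /= => yy0; rewrite mcoeffZ mcoeffX -y0m.
  by rewrite (inj_eq mon_inj) (negPf yy0) mulr0.
pose b := pt (res (val x)).
pose l : {mpoly K[n]} := \sum_(y : I | res (val y) == res (val x)) c y *: 'X_[quo (val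
  y)].
have lE : \sum_(a <- msupp l) l@_a *: fpow f a =
    \sum_(y : I | res (val y) == res (val x)) c y *: fpow f (quo (val y)).
  have FX a : 'X_[a] \mPo [tuple f i | i < n] = fpow f a.
    by rewrite comp_mpolyX; apply: eq_bigr => i _; rewrite tnth_mktuple.
  transitivity (l \mPo [tuple f i | i < n]).
    rewrite [in RHS](mpolyE l) (raddf_sum (comp_mpoly _)).
    by apply: eq_bigr => a _; rewrite /= comp_mpolyZ FX.
  rewrite (raddf_sum (comp_mpoly _)).
  by apply: eq_bigr => y _; rewrite /= comp_mpolyZ FX.
have l0 : l = 0.
  apply: (NP b _ l _ _ cP) => [i|a|]; first exact: f_pt.
    move=> /msupp_sum_le/flatten_mapP[y _ /msuppZ_le].
    rewrite msuppX inE => /eqP->.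
    have := valP y; rewrite inE; apply: leq_ltn_trans; apply: leq_sum => i _.
    by rewrite mnmE mulnC leq_trunc_div.
  rewrite lE [X in _ - X](bigID (fun y : I => res (val y) == res (val x))) /= opprD addrA.
  rewrite -sumrB; apply: (idealB (vanish_order_ideal _ _)).
    apply: (ideal_sum (vanish_order_ideal _ _)) => y /eqP yx;
      rewrite -scalerBr -mul_mpolyC.
    apply: (idealMl (vanish_order_ideal _ _)); rewrite -{1}[fpow f _]mulr1 -mulrBr.
    apply: (idealMl (vanish_order_ideal _ _)); rewrite -opprB;
      apply: (idealN (vanish_order_ideal _ _)).
    by rewrite /b -yx; have [] := eP (val y).
  apply: (ideal_sum (vanish_order_ideal _ _)) => y yx; rewrite -mul_mpolyC.
  do 2!apply: (idealMl (vanish_order_ideal _ _)).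
  by have [_] := eP (val y); apply.
have := congr1 (mcoeff (quo (val x))) l0.
rewrite mcoeff0 raddf_sum (bigD1 x) //= mcoeffZ mcoeffX eqxx mulr1 big1 ?addr0 // => y
  /andP[/eqP rxy xy].
rewrite mcoeffZ mcoeffX (_ : _ == _ = false) ?mulr0 //.
by apply: contraNF xy => /eqP qxy; apply/eqP/val_inj/quo_res_inj.
Qed.

End TooManyZeros.

(** The two regions of exponents have the same leading volume, up to a corner
    of linear size that only the first one contains. *)
Lemma exponents_region n (j : 'I_n) (K0 C : nat) : (0 < K0)%N ->
  exists v, let L := (K0 * v + C)%N in
  (#|[set x : {ffun 'I_n -> 'I_L} | (\sum_i x i < L) && (x j + v <= L)]| <
   #|[set x : {ffun 'I_n -> 'I_L} | \sum_i x i < K0 * v]|)%N.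
Proof.
move=> K0_gt0; have n0 : (0 < n)%N by apply: leq_ltn_trans (ltn_ord j).
pose Q := (K0 * (n + C + 1) + C)%N.
have [M [M0 MQ]] : exists M, (0 < M)%N /\ (C * Q ^ n.-1 < M)%N.
  by exists (C * Q ^ n.-1).+1.
pose v := (n * M + C + 1)%N.
exists v => L; pose w := (K0 * v)%N.
have LE : L = (w + C)%N by [].
set B := [set x | _]; set A := [set x | _].
have vw : (v <= w)%N by rewrite leq_pmull.
have LQ : (L <= M * Q)%N.
  have h1 : (K0 * (C + 1) <= M * (K0 * (C + 1)))%N by rewrite leq_pmull.
  have h2 : (C <= M * C)%N by rewrite leq_pmull.
  by move: h1 h2; rewrite /L /v /Q; lia.
have upper : (#|B :\: A| <= C * L ^ n.-1)%N.
  pose h (x : {ffun 'I_n -> 'I_L}) : option ('I_C * {ffun 'I_n.-1 -> 'I_L}) :=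
    if insub (\sum_i x i - w)%N is Some d then Some (d, [ffun i => x (lift j i)]) else
      None.
  have hE x : x \in B :\: A -> exists d : 'I_C,
      h x = Some (d, [ffun i => x (lift j i)]) /\ (\sum_i x i = w + d)%N.
    rewrite !inE -leqNgt => /andP[wx /andP[xL _]].
    have dC : (\sum_i x i - w < C)%N by rewrite -/w in wx *; move: xL wx;
      move: (\sum_i _)%N LE; clearbody L; lia.
    exists (Ordinal dC); split; last by rewrite /= subnKC.
    by rewrite /h insubT; congr (Some (_, _)); apply/val_inj.
  have h_inj : {in B :\: A &, injective h}.
    move=> x y /hE[d [-> dx]] /hE[d' [-> dy]] [dd /ffunP xy].
    have xyl i : x (lift j i) = y (lift j i) by have := xy i; rewrite !ffunE.
    have xyj : x j = y j.
      apply/val_inj/eqP => /=; have : (\sum_i x i = \sum_i y i)%N by rewrite dx dy dd.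
      rewrite (bigD1_ord j) //= [X in _ = X](bigD1_ord j) //=.
      by under eq_bigr do rewrite xyl; move/eqP; rewrite eqn_add2r.
    by apply/ffunP => i; case: (unliftP j i) => [i'|] ->.
  rewrite -(card_in_imset h_inj).
  pose Y : {set option ('I_C * {ffun 'I_n.-1 -> 'I_L})} := [set Some x | x : 'I_C * {ffun
    'I_n.-1 -> 'I_L}].
  have -> : (C * L ^ n.-1 = #|Y|)%N.
    by rewrite card_imset ?card_prod ?card_ffun ?card_ord //; exact: Some_inj.
  by apply/subset_leq_card/subsetP => _ /imsetP[x /hE[d [hx _]] ->]; rewrite hx imset_f.
have lower : (M ^ n <= #|A :\: B|)%N.
  have gL (g : {ffun 'I_n -> 'I_M}) i : (g i + (i == j) * (w + C + 1 - v) < L)%N.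
    have gi : (g i < M)%N by [].
    have : (M <= n * M)%N by rewrite leq_pmull.
    by move: vw LE gi; rewrite /v; clearbody w L; case: (i == j); rewrite ?mul1n ?mul0n;
      lia.
  pose h (g : {ffun 'I_n -> 'I_M}) : {ffun 'I_n -> 'I_L} := [ffun i => Ordinal (gL g i)].
  have h_inj : injective h.
    move=> g g' /ffunP e; apply/ffunP => i; apply/val_inj/eqP.
    by have := congr1 val (e i); rewrite !ffunE /= => /eqP; rewrite eqn_add2r.
  have -> : (M ^ n = #|[set h g | g : {ffun 'I_n -> 'I_M}]|)%N.
    by rewrite card_imset // card_ffun !card_ord.
  apply/subset_leq_card/subsetP => _ /imsetP[g _ ->]; rewrite !inE ffunE /= eqxx mul1n.
  have -> : (g j + (w + C + 1 - v) + v <= L)%N = false by move: vw LE; clearbody w L; lia.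
  rewrite andbF /=; under eq_bigr do rewrite ffunE /=.
  rewrite big_split /= [X in (_ + X)%N](bigD1 j) //= eqxx mul1n.
  rewrite [X in (_ + (_ + X))%N]big1 => [|i /negPf->]; last by rewrite mul0n.
  have : (\sum_i g i <= n * M.-1)%N.
    have -> : (n * M.-1 = \sum_(i < n) M.-1)%N by rewrite sum_nat_const card_ord.
    apply: leq_sum => i _.
    by rewrite -ltnS prednK.
  have : (n * M.-1 + n = n * M)%N by rewrite -mulnSr prednK.
  by move: vw n0; rewrite addn0 -/w /v; move: (\sum_i _)%N => S; clearbody w; lia.
have := cardsID B A; have := cardsID A B; rewrite setIC => <- <-.
rewrite ltn_add2l (leq_ltn_trans upper) // (leq_trans _ lower) //.
apply: (@leq_ltn_trans (C * (M * Q) ^ n.-1)); first rewrite leq_mul2l.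
  by case: n.-1 => [|e]; rewrite ?expn0 ?leqnn ?leq_exp2r ?LQ ?orbT.
have -> : (M ^ n = M * M ^ n.-1)%N by rewrite -expnS prednK.
by rewrite expnMn mulnCA mulnC ltn_pmul2r ?expn_gt0 ?M0.
Qed.

Section FiniteCodimension.
Variables (n : nat) (K : closedFieldType).
Implicit Types (p q r : {mpoly K[n]}).

Let monic_in i e p := (msize ('X_i ^+ e - p) <= e)%N.

Lemma msizeMW d e p q : (msize p <= d)%N -> (msize q <= e)%N -> (msize (p * q) <= (d +
  e).-1)%N.
Proof.
have [->|p0] := eqVneq p 0; first by rewrite mul0r msize0.
have [->|q0] := eqVneq q 0; first by rewrite mulr0 msize0.
move=> pd qe; rewrite msizeM // -!subn1; apply: leq_sub2r; exact: leq_add.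
Qed.

Lemma msizeXn i e : msize ('X_i ^+ e : {mpoly K[n]}) = e.+1.
Proof. by rewrite mpolyXn msizeX mdegMn mdeg1 mul1n. Qed.

Lemma msizeDW d p q : (msize p <= d)%N -> (msize q <= d)%N -> (msize (p + q) <= d)%N.
Proof. by move=> pd qd; rewrite (leq_trans (msizeD_le _ _)) // geq_max pd. Qed.

Lemma monic_inM i d e p q : monic_in i d p -> monic_in i e q -> monic_in i (d + e) (p *
  q).
Proof.
rewrite /monic_in => pd qe.
have szq : (msize q <= e.+1)%N.
  rewrite -[q](subKr ('X_i ^+ e)); apply: msizeDW; first by rewrite msizeXn.
  by rewrite msizeN leqW.
have -> : 'X_i ^+ (d + e) - p * q = 'X_i ^+ d * ('X_i ^+ e - q) + ('X_i ^+ d - p) * q.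
  by rewrite exprD; ring.
apply: msizeDW.
  by apply: leq_trans (msizeMW (eq_leq (msizeXn i d)) qe) _; lia.
by apply: leq_trans (msizeMW pd szq) _; lia.
Qed.

(** By the Nullstellensatz a power of [\prod_z (x_i - z_i)] lies in [I], so a
    large power of [x_i] can be traded for terms of smaller degree. *)
Lemma finite_zeros_codim (I : {mpoly K[n]} -> Prop) (Z : seq ('I_n -> K)) :
  ideal I -> (forall v, (forall p, I p -> p.@[v] = 0) -> exists2 z, List.In z Z & v =1 z)
    ->
  exists C, forall q, exists2 r, (msize r <= C)%N & I (q - r).
Proof.
move=> idI ZI.
have /choice[e eP] i : exists e, exists2 p, I p & monic_in i e p.
  pose h : {mpoly K[n]} := \prod_(z <- Z) ('X_i - (z i)%:MP).
  have [N hN] : exists N, I (h ^+ N).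
    apply: nullstellensatz => // v /ZI[z zZ vz]; rewrite rmorph_prod /=.
    elim: Z zZ {ZI h} => //= z' Z IHZ [->|/IHZ zZ]; rewrite big_cons;
      last by rewrite zZ mulr0.
    by rewrite mevalB mevalXU mevalC vz subrr mul0r.
  exists (size Z * N)%N, (h ^+ N) => //.
  have hZ : monic_in i (size Z) h.
    rewrite /h; elim: (Z) => [|z Z' IHZ];
      first by rewrite big_nil /monic_in expr0 subrr msize0.
    rewrite big_cons /= -add1n; apply: monic_inM => //.
    by rewrite /monic_in expr1 opprB addrC subrK msizeC; case: (_ != 0).
  elim: N {hN} => [|N IHN]; first by rewrite muln0 /monic_in !expr0 subrr msize0.
  by rewrite mulnS exprS; apply: monic_inM.
exists (\sum_i e i).+1.
pose good q := exists2 r, (msize r <= (\sum_i e i).+1)%N & I (q - r).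
have goodD p q : good p -> good q -> good (p + q).
  move=> [r szr Ir] [s szs Is]; exists (r + s); first exact: msizeDW.
  by rewrite opprD addrACA; apply: idealD.
have goodZ c p : good p -> good (c *: p).
  move=> [r szr Ir]; exists (c *: r); first exact: leq_trans (msizeZ_le _ _) szr.
  by rewrite -scalerBr -mul_mpolyC; apply: idealMl.
have good0 : good 0 by exists 0; rewrite ?msize0 ?subrr //; exact: ideal0.
have goodI p : I p -> good p by exists 0; rewrite ?msize0 ?subr0.
suff goodd d q : (msize q <= d)%N -> good q by move=> q; apply: (goodd (msize q)).
elim: d q => [|d IHd] q; first by rewrite leqn0 msize_poly_eq0 => /eqP->.
move=> szq; rewrite (mpolyE q) big_seq; apply: big_ind => // m mq; apply: (goodZ).
have md : (mdeg m <= d)%N by rewrite -ltnS (leq_trans _ szq) // msize_mdeg_lt.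
have [lt_me|] := boolP [forall i, m i < e i]%N.
  exists 'X_[m]; last by rewrite subrr; exact: ideal0.
  by rewrite msizeX ltnS mdegE; apply: leq_sum => i _; apply/ltnW/(forallP lt_me).
move=> /forallP nlt; have [i le_em] : exists i, (e i <= m i)%N.
  apply: contrapT => noi; apply: nlt => i; rewrite ltnNge; apply/negP => le_em.
  by apply: noi; exists i.
have mE : m = (m - U_(i) *+ e i + U_(i) *+ e i)%MM.
  rewrite submK //; apply/mnm_lepP => i'; rewrite mulmnE mnm1E.
  by case: eqP => [<-|_]; rewrite ?mul1n ?mul0n.
have [p Ip pmon] := eP i.
have -> : 'X_[m] = 'X_[m - U_(i) *+ e i] * ('X_i ^+ e i - p) + 'X_[m - U_(i) *+ e i] * p
  :> {mpoly K[n]}.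
  by rewrite -mulrDr subrK mpolyXn -mpolyXD -mE.
apply: (goodD); last by apply/goodI/(idealMl idI).
apply: IHd; apply: leq_trans (msizeMW (leqnn _) pmon) _.
have := congr1 mdeg mE; rewrite mdegD mdegMn mdeg1 mul1n msizeX; lia.
Qed.

End FiniteCodimension.

Lemma msize_dhomog n (K : fieldType) d (p : {mpoly K[n]}) : p \is d.-homog -> (msize p <=
  d.+1)%N.
Proof. by move=> /dhomogP hp; rewrite msizeE; apply/bigmax_leqP_seq => m /hp ->. Qed.

Section LinearSubstitution.
Variables (n : nat) (K : fieldType) (lq : n.-tuple {mpoly K[n]}).
Hypothesis lq_lin : forall i, tnth lq i \is 1.-homog.

Lemma comp_mpoly_homogX (m : 'X_{1..n}) : 'X_[m] \mPo lq \is (mdeg m).-homog.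
Proof.
rewrite comp_mpolyX mdegE;
  apply: (big_ind2 (fun d p => p \is d.-homog)) => [|d p e q|i _].
- exact: dhomog1.
- exact: dhomogM.
by have := dhomogMn (m i) (lq_lin i); rewrite mul1n.
Qed.

Lemma pihomog_comp_linear d p : pihomog mdeg d (p \mPo lq) = pihomog mdeg d p \mPo lq.
Proof.
rewrite {1}(mpolyE p) (pihomogE _ _ p) (raddf_sum (comp_mpoly lq)) (raddf_sum (comp_mpoly
  lq)).
rewrite (raddf_sum (pihomog mdeg d)) [RHS]big_mkcond; apply: eq_bigr => m _ /=.
rewrite !comp_mpolyZ linearZ /=; case: eqP => [<-|/eqP md].
  by rewrite pihomog_dE // comp_mpoly_homogX.
by rewrite (pihomog_ne0 _ (comp_mpoly_homogX m)) ?scaler0.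
Qed.

Lemma msize_comp_linear d p : (msize p <= d)%N -> (msize (p \mPo lq) <= d)%N.
Proof.
move=> pd; rewrite (mpolyE p) (raddf_sum (comp_mpoly lq)).
apply: leq_trans (msize_sum _ _ _) _; apply/bigmax_leqP_seq => m mp _.
rewrite /= comp_mpolyZ (leq_trans (msizeZ_le _ _)) //.
apply: leq_trans (msize_dhomog (comp_mpoly_homogX m)) _.
by apply: leq_trans pd; apply: msize_mdeg_lt.
Qed.

End LinearSubstitution.

Lemma mnm_eq_top n (m : 'X_{1..n}) j d :
  (mdeg m <= d)%N -> (d <= m j)%N -> m = (U_(j) *+ d)%MM.
Proof.
rewrite mdegE (bigD1 j) //=; set S := (\sum_(i | _) _)%N => md dm.
apply/mnmP => i; rewrite mulmnE mnm1E.
have [<-|ij] := eqVneq j i; first by rewrite mul1n; lia.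
have : (m i <= S)%N by rewrite /S (bigD1 i) 1?eq_sym //= leq_addr.
by move: md dm; rewrite mul0n; lia.
Qed.

Lemma mcoeff_top n (K : fieldType) (p : {mpoly K[n]}) (j : 'I_n) d :
  (pihomog mdeg d p).@[fun i => (i == j)%:R] = p@_(U_(j) *+ d).
Proof.
have evalX (m : 'X_{1..n}) : mdeg m = d ->
    ('X_[m] : {mpoly K[n]}).@[fun i => (i == j)%:R] = (m == (U_(j) *+ d)%MM)%:R.
  move=> md; rewrite mevalX; case: eqP => [->|ne].
    rewrite big1 // => i _; rewrite mulmnE mnm1E eq_sym.
    by case: eqP => _; rewrite ?expr1n ?mul0n ?expr0.
  have [i ij mi] : exists2 i, i != j & m i != 0%N.
    apply: contrapT => noi; apply: ne; apply: mnm_eq_top; first by rewrite md.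
    rewrite -md mdegE (bigD1 j) //= big1 ?addn0 // => i ij; apply/eqP/negPn/negP => mi.
    by apply: noi; exists i.
  by rewrite (bigD1 i) //= (negPf ij) expr0n (negPf mi) mul0r.
rewrite (pihomogE _ _ p) (raddf_sum (meval _)).
under eq_bigr => m /eqP md do rewrite /= mevalZ evalX //.
rewrite [in RHS](mpolyE p) (raddf_sum (mcoeff _)) big_mkcond; apply: eq_bigr => m _ /=.
rewrite mcoeffZ mcoeffX; case: ifPn => // md; case: eqP => [mE|_]; last by rewrite mulr0.
by case/eqP: md; rewrite mE mdegMn mdeg1 mul1n.
Qed.

Section NoZeroAtInfinity.
Variables (n : nat) (K : closedFieldType) (f : 'I_n -> {mpoly K[n]}) (k : 'I_n -> nat).
Variable pts : seq 'rV[K]_n.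
Hypothesis k_gt0 : forall i, (0 < k i)%N.
Hypothesis deg_f : forall i, (msize (f i) <= (k i).+1)%N.
Hypothesis uniq_pts : uniq pts.
Hypothesis size_pts : size pts = (\prod_i k i)%N.
Hypothesis ptsP : forall x : 'rV[K]_n, (x \in pts) = [forall i, (f i).@[x 0] == 0].

Lemma residues_to_points : exists pt : 'X_{1..n} -> 'rV[K]_n,
  (forall r, pt r \in pts) /\
  (forall r s : 'X_{1..n}, (forall i, r i < k i)%N -> (forall i, s i < k i)%N ->
     r != s -> pt r != pt s).
Proof.
pose R := [seq [multinom (g i : nat) | i < n] | g : {dffun forall i : 'I_n, 'I_(k i)}].
have RP (r : 'X_{1..n}) : (forall i, r i < k i)%N -> r \in R.
  move=> rk; apply/mapP; exists (finfun (fun i => Ordinal (rk i)));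
    first by rewrite mem_enum.
  by apply/mnmP => i; rewrite mnmE ffunE.
have sizeR : size R = size pts.
  rewrite size_map -cardE card_dep_ffun size_pts foldrE big_map.
  rewrite big_enum /=; apply: eq_bigr => i _; exact: card_ord.
have pts_gt0 : (0 < size pts)%N by rewrite size_pts prodn_gt0.
exists (fun r => nth (nth 0 pts 0) pts (index r R)); split.
  move=> r; have [lt|ge] := ltnP (index r R) (size pts); first exact: mem_nth.
  by rewrite nth_default // mem_nth.
move=> r s /RP rR /RP sR; apply: contra_neq => /eqP.
rewrite nth_uniq -?sizeR ?index_mem // => /eqP e.
by rewrite -(nth_index 0%MM rR) e nth_index.
Qed.

(** Once a zero at infinity is moved to a coordinate direction [j], no [f i]
    contains [x_j^(k i)] any more, and [\prod_i k i] finite zeros are too many: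
    [leq_card_exponents] contradicts [exponents_region]. *)
Lemma no_zero_at_infinity (y : 'I_n -> K) :
  (forall i, (pihomog mdeg (k i) (f i)).@[y] = 0) -> forall j, y j = 0.
Proof.
move=> Fy j; apply/eqP/negPn/negP => yj.
pose lq := [tuple (if i == j then y j *: 'X_j else 'X_i + y i *: 'X_j) : {mpoly K[n]} | i
  < n].
have homX i : ('X_i : {mpoly K[n]}) \is 1.-homog by rewrite dhomogX /= mdeg1.
have lq_lin i : tnth lq i \is 1.-homog.
  by rewrite tnth_mktuple; case: eqP => _; rewrite ?rpredD ?rpredZ ?homX.
pose g i := f i \mPo lq.
pose al (v : 'I_n -> K) i := if i == j then y j * v j else v i + y i * v j.
have geval i v : (g i).@[v] = (f i).@[al v].
  rewrite /g comp_mpoly_meval; apply: meval_eq => i'; rewrite tnth_mktuple /al.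
  by case: eqP => _; rewrite ?mevalD !mevalZ !mevalXU.
pose be (x : 'rV[K]_n) i := if i == j then x 0 j / y j else x 0 i - y i * (x 0 j / y j).
have albe x : al (be x) =1 x 0.
  by move=> i; rewrite /al /be eqxx; case: eqP => [->|_]; rewrite ?subrK // mulrC divfK.
have beal v : be (\row_i al v i) =1 v.
  move=> i; rewrite /be /al !mxE eqxx; case: eqP => [->|_]; first by rewrite mulrC mulKf.
  by rewrite [y j * _]mulrC mulfK // addrK.
have [|C codim] := @finite_zeros_codim n K (wpow g k 1) [seq be x | x <- pts] (wpow_ideal
  _ _ _).
  move=> v vZ; exists (be (\row_i al v i)); last by move=> i; rewrite beal.
  have: \row_i al v i \in pts.
    rewrite ptsP; apply/forallP => i; apply/eqP.
    rewrite (meval_eq (v2 := al v)) => [|i']; last by rewrite mxE.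
    rewrite -geval; apply: vZ; rewrite -[g i]mulr1.
    have -> : g i = fpow g U_(i)%MM.
      rewrite /fpow (bigD1 i) //= mnm1E eqxx expr1 big1 ?mulr1 // => i' ii'.
      by rewrite mnm1E eq_sym (negPf ii') expr0.
    by apply: wpow_gen; rewrite /wt (bigD1 i) //= mnm1E eqxx muln1 ltn_addr.
  elim: (pts) => //= x s IHs; rewrite inE => /orP[/eqP->|/IHs]; first by left.
  by right.
have [pt [ptZ pt_sep]] := residues_to_points.
have kmax_gt0 : (0 < kmax k)%N by apply: leq_trans (leq_k_kmax k j).
have [v] := exponents_region j C kmax_gt0.
apply/negP; rewrite -leqNgt.
apply: (@leq_card_exponents n K g k j C (fun r => be (pt r))) => //.
- move=> i m /msize_mdeg_lt mg; rewrite -ltnS; apply: leq_trans mg _.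
  exact: msize_comp_linear.
- move=> i m mg; have mk : (mdeg m <= k i)%N.
    rewrite -ltnS; apply: leq_trans (msize_mdeg_lt mg) _; exact: msize_comp_linear.
  rewrite -ltnS prednK // ltnNge; apply/negP => kmj.
  have mE : m = (U_(j) *+ k i)%MM.
    exact: mnm_eq_top.
  move: mg; rewrite mcoeff_msupp mE -mcoeff_top /g pihomog_comp_linear //
    comp_mpoly_meval.
  rewrite (meval_eq (v2 := y)) ?Fy ?eqxx // => i'; rewrite tnth_mktuple.
  by case: eqP => [->|/eqP/negPf ij];
    rewrite ?mevalD !mevalZ !mevalXU ?eqxx ?ij ?mulr1 ?add0r.
- move=> r i; rewrite geval (meval_eq (v2 := pt r 0)); last exact: albe.
  by apply/eqP; have := ptZ r; rewrite ptsP => /forallP.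
move=> r s rk sk /(pt_sep _ _ rk sk) rs.
have [//|noi] := pselect (exists i, be (pt r) i != be (pt s) i).
case/eqP: rs; apply/rowP => i; rewrite -[LHS]albe -[RHS]albe.
have bers : be (pt r) =1 be (pt s).
  by move=> i'; apply/eqP/negPn/negP => h; apply: noi; exists i'.
by rewrite /al !bers.
Qed.

End NoZeroAtInfinity.

(** * The expected Hilbert function *)

(** The coefficients of [(1 - t)^(-n)]. *)
Fixpoint geom_coef (n j : nat) : int :=
  if n is n'.+1 then \sum_(i < j.+1) geom_coef n' i else (j == 0)%:R.

Lemma geom_coefE n j : geom_coef n.+1 j = ('C(j + n, j))%:Z.
Proof.
elim: n j => [|n IHn] j.
  by rewrite addn0 binn /= big_ord_recl big1 ?addr0.
have -> : geom_coef n.+2 j = \sum_(i < j.+1) geom_coef n.+1 i by [].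
rewrite (eq_bigr (fun i : 'I_j.+1 => ('C(i + n, i))%:Z)) => [|i _]; last exact: IHn.
elim: j => [|j IHj]; first by rewrite big_ord1 !bin0.
by rewrite big_ord_recr /= IHj -PoszD !(addnS, addSn) binS addnC.
Qed.

(** The coefficients of [\prod_d (1 - t^d) (1 - t)^(-n)]. *)
Definition hilb_seq n (ds : seq nat) : fps :=
  fps_mul (fps_of_poly (\prod_(d <- ds) (1 - 'X^d))) (geom_coef n).

Lemma fps_mul_shift (p : {poly int}) d (b : fps) e :
  fps_mul (fps_of_poly ((1 - 'X^d) * p)) b e =
  fps_mul (fps_of_poly p) b e - (if (d <= e)%N then fps_mul (fps_of_poly p) b (e - d)%N
    else 0).
Proof.
rewrite /fps_mul /fps_of_poly mulrBl mul1r.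
under eq_bigr do rewrite coefB mulrBl.
rewrite sumrB; congr (_ - _).
under eq_bigr do rewrite coefXnM.
case: leqP => de; last first.
  rewrite big1 // => i _; rewrite ifT ?mul0r //; have := ltn_ord i; lia.
rewrite -(big_mkord predT (fun i => (if (i < d)%N then 0 else p`_(i - d)) * b (e - i)%N)).
rewrite (big_cat_nat (n := d)) //=; last by lia.
rewrite big1_seq ?add0r => [|i]; last by rewrite mem_index_iota => /andP[_ /andP[_ ->]];
  rewrite mul0r.
rewrite -{1}[d]add0n big_addn big_mkord -subSn //; apply: eq_bigr => i _.
by rewrite ltnNge leq_addl addnK; congr (_ * b _); lia.
Qed.

Lemma hilb_seq_nil n e : hilb_seq n [::] e = geom_coef n e.
Proof.
rewrite /hilb_seq /fps_mul /fps_of_poly big_nil big_ord_recl coef1 mul1r subn0 big1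
  ?addr0 // => i _.
by rewrite coef1 mul0r.
Qed.

Lemma hilb_seq_cons n d ds e : hilb_seq n (d :: ds) e =
  hilb_seq n ds e - (if (d <= e)%N then hilb_seq n ds (e - d)%N else 0).
Proof. by rewrite /hilb_seq big_cons fps_mul_shift. Qed.

Lemma hilb_seq_perm n ds ds' e : perm_eq ds ds' -> hilb_seq n ds e = hilb_seq n ds' e.
Proof. by move=> dd; rewrite /hilb_seq (perm_big _ dd). Qed.

Lemma hilb_seq_sum n ds e : hilb_seq n.+1 ds e = \sum_(j < e.+1) hilb_seq n ds j.
Proof.
elim: ds e => [|d ds IHds] e.
  by rewrite hilb_seq_nil /=; apply: eq_bigr => j _; rewrite hilb_seq_nil.
under eq_bigr do rewrite hilb_seq_cons.
rewrite hilb_seq_cons !IHds sumrB; congr (_ - _).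
rewrite -(big_mkord predT (fun j => if (d <= j)%N then hilb_seq n ds (j - d)%N else 0)).
case: leqP => de; last first.
  by rewrite big1_seq // => j; rewrite mem_index_iota => /andP[_ /andP[_ je]];
    rewrite leqNgt ifF //; lia.
rewrite (big_cat_nat (n := d)) //=; last by lia.
rewrite [X in _ = X + _]big1_seq ?add0r => [|j];
  last by rewrite mem_index_iota => /andP[_ /andP[_ je]]; rewrite leqNgt je.
rewrite -[X in index_iota X]add0n big_addn big_mkord -subSn //; apply: eq_bigr => i _.
by rewrite leq_addl addnK.
Qed.

(** With one equation less than variables the coefficients are bounded: the
    series is [\prod_d (1 + t + ... + t^(d-1)) / (1 - t)]. *)
Lemma hilb_seq_le n ds e : size ds = n -> hilb_seq n.+1 ds e <= (\prod_(d <- ds) d)%:Z.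
Proof.
elim: ds n e => [|d ds IHds] n e /=.
  by move=> <-; rewrite hilb_seq_nil geom_coefE big_nil addn0 binn.
case: n => // n [szds]; rewrite hilb_seq_cons big_cons !hilb_seq_sum PoszM.
set P := (\prod_(d <- ds) d)%N.
have le_sum (r : seq nat) : \sum_(j <- r) hilb_seq n.+1 ds j <= (size r)%:Z * P%:Z.
  elim: r => [|j r IHr]; first by rewrite big_nil mul0r.
  by rewrite big_cons /= intS mulrDl mul1r lerD // IHds.
rewrite -(big_mkord predT (hilb_seq n.+1 ds)); case: leqP => de.
  rewrite -(big_mkord predT (hilb_seq n.+1 ds)) (big_cat_nat (n := (e - d).+1)) //=;
    last by lia.
  rewrite addrAC subrr add0r; apply: le_trans (le_sum _) _; rewrite size_iota.
  by rewrite ler_wpM2r //; lia.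
rewrite subr0; apply: le_trans (le_sum _) _; rewrite size_iota ler_wpM2r //; lia.
Qed.

Lemma fps_inv_unique (a b : fps) :
  a 0%N = 1 -> (forall j, fps_mul a b j = (j == 0)%:R) -> b =1 fps_inv a.
Proof.
move=> a0 ab j; have [m] := ubnP j; elim: m j => // m IHm j jm.
have := fps_mulV j a0; rewrite -ab /fps_mul !big_ord_recl a0 !mul1r subn0.
rewrite (eq_bigr (fun i : 'I_j => a (lift ord0 i) * b (j - lift ord0 i)%N));
  first by move/addIr.
by move=> i _; rewrite IHm // lift0; have := ltn_ord i; lia.
Qed.

Lemma hilb_seq_nseq1 n e : hilb_seq n (nseq n 1%N) e = (e == 0)%:R.
Proof.
elim: n e => [|n IHn] e; first by rewrite hilb_seq_nil.
rewrite /= hilb_seq_cons !hilb_seq_sum big_ord_recr /= IHn.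
case: e => [|e]; first by rewrite big_ord0 subr0 add0r.
by rewrite subn1 addrAC subrr add0r.
Qed.

Lemma geom_coef_inv n : geom_coef n =1 fps_inv (fps_of_poly ((1 - 'X) ^+ n)).
Proof.
apply: fps_inv_unique => [|j].
  by rewrite /fps_of_poly -horner_coef0 !hornerE expr1n.
have -> : (1 - 'X) ^+ n = \prod_(d <- nseq n 1%N) (1 - 'X^d) :> {poly int}.
  by rewrite big_nseq expr1 -Monoid.iteropE.
exact: hilb_seq_nseq1.
Qed.

Lemma hilb_coef_sum n s (k : 'I_s -> nat) m :
  \sum_(j < m.+1) hilb_coef n k j = hilb_seq n.+1 [seq k i | i <- enum 'I_s] m.
Proof.
rewrite hilb_seq_sum; apply: eq_bigr => j _.
rewrite /hilb_coef /hilb_seq big_map big_enum /=.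
by apply: eq_bigr => i _; rewrite geom_coef_inv.
Qed.

(** * Hilbert functions of homogeneous ideals *)

Section VspaceOfSubspace.
Variables (K : fieldType) (V : vectType K) (P : V -> Prop).

Lemma vspace_of_subspace : subspace P -> exists U : {vspace V}, forall v, v \in U <-> P v.
Proof.
move=> [P0 PD PZ].
have ex : exists d, `[< exists2 U : {vspace V}, (forall v, v \in U -> P v) & \dim U = d
  >].
  exists 0%N; apply/asboolP; exists 0%VS; rewrite ?dimv0 // => v.
  by rewrite memv0 => /eqP->.
have bound d : `[< exists2 U : {vspace V}, (forall v, v \in U -> P v) & \dim U = d >] ->
    (d <= \dim {:V})%N.
  by move=> /asboolP[U _ <-]; exact/dimvS/subvf.
have [d /asboolP[U UP dU] dmax] := ex_maxnP ex bound.
exists U => v; split=> [/UP//|Pv].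
have UvP w : w \in (U + <[v]>)%VS -> P w.
  by case/memv_addP => u uU [_ /vlineP[a ->] ->]; apply: PD (UP _ uU) (PZ _ _ Pv).
have /eqP -> : U == (U + <[v]>)%VS.
  rewrite eqEdim addvSl /= dU; apply: dmax; apply/asboolP.
  by exists (U + <[v]>)%VS.
by rewrite memvE addvSr.
Qed.

End VspaceOfSubspace.

(** Peeling off one generator at a time makes membership in [(g) + I] an
    existential statement about membership in [I], which suits inductions on
    the list. *)
Fixpoint gen_ideal (A : comNzRingType) (gs : seq A) (p : A) : Prop :=
  if gs is g :: gs' then exists a, gen_ideal gs' (p - a * g) else p = 0.

Section GenIdeal.
Variable A : comNzRingType.
Implicit Types (gs : seq A) (p q : A).

Lemma gen_ideal_ideal gs : ideal (gen_ideal gs).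
Proof.
elim: gs => [|g gs IHgs] /=.
  by split=> // [_ _ -> ->|a _ ->]; rewrite ?addr0 ?mulr0.
split=> [|p q [a pa] [b qb]|c p [a pa]].
- by exists 0; rewrite mul0r subr0; exact: ideal0 IHgs.
- by exists (a + b); rewrite mulrDl opprD addrACA; exact: idealD.
by exists (c * a); rewrite -mulrA -mulrBr; exact: idealMl.
Qed.

Lemma gen_ideal_mem gs g : g \in gs -> gen_ideal gs g.
Proof.
elim: gs => //= h gs IHgs; rewrite inE => /orP[/eqP<-|/IHgs gI].
  by exists 1; rewrite mul1r subrr; exact: ideal0 (gen_ideal_ideal _).
by exists 0; rewrite mul0r subr0.
Qed.

Lemma gen_ideal_min gs (I : A -> Prop) :
  ideal I -> (forall g, g \in gs -> I g) -> forall p, gen_ideal gs p -> I p.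
Proof.
move=> idI; elim: gs => /= [_ _ ->|g gs IHgs gsI p [a pa]]; first exact: ideal0 idI.
rewrite -(subrK (a * g) p); apply: (idealD idI).
  by apply: IHgs => // h hgs; apply: gsI; rewrite inE hgs orbT.
by apply/(idealMl idI)/gsI; rewrite mem_head.
Qed.

Lemma gen_ideal_sub gs hs : {subset gs <= hs} -> forall p, gen_ideal gs p -> gen_ideal hs
  p.
Proof.
move=> gh; apply: gen_ideal_min (gen_ideal_ideal _) _ => g /gh; exact: gen_ideal_mem.
Qed.

End GenIdeal.

Section HilbertFunction.
Variables (n : nat) (K : fieldType).
Local Notation A := {mpoly K[n.+1]}.
Local Notation S := (dhomog n.+1 K).
Implicit Types (p q g : A) (G : seq (nat * A)).

(** A list of forms, each tagged with its degree, which matters when the form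
    is zero. *)
Definition forms G := forall x, x \in G -> (0 < x.1)%N /\ x.2 \is x.1.-homog.

Definition form_ideal G := gen_ideal (map snd G).

Lemma form_ideal_ideal G : ideal (form_ideal G). Proof. exact: gen_ideal_ideal. Qed.

Lemma forms_cons x G : forms (x :: G) -> [/\ (0 < x.1)%N, x.2 \is x.1.-homog & forms G].
Proof.
move=> h; have [x1 x2] := h x (mem_head _ _); split=> // y yG.
by apply: h; rewrite inE yG orbT.
Qed.

Lemma pihomogM e d p g : g \is d.-homog ->
  pihomog mdeg e (p * g) = if (d <= e)%N then pihomog mdeg (e - d) p * g else 0.
Proof.
move=> gd; have [k pk] : exists k, (msize p <= k)%N by exists (msize p).
rewrite {1}(pihomog_partitionE pk) mulr_suml raddf_sum /=.
have E (i : 'I_k) : pihomog mdeg e (pihomog mdeg i p * g) =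
    if (i + d == e)%N then pihomog mdeg i p * g else 0.
  have h : pihomog mdeg i p * g \is (i + d).-homog by apply: dhomogM => //;
    exact: pihomogP.
  by case: eqP => [<-|/eqP ne]; [rewrite pihomog_dE | rewrite (pihomog_ne0 _ h)].
under eq_bigr do rewrite E.
case: leqP => de; last first.
  by rewrite big1 // => i _; rewrite ifF //; apply/eqP; lia.
have [lt|ge] := ltnP (e - d) k.
  rewrite (bigD1 (Ordinal lt)) //= subnK // eqxx big1 ?addr0 // => i;
    rewrite -val_eqE /= => ne.
  by rewrite ifF //; apply/eqP => ie; move/eqP: ne; apply; rewrite -ie addnK.
have -> : pihomog mdeg (e - d) p = 0.
  rewrite (pihomogwE _ _ pk) big1 // => m /eqP md; have := bmdeg m.
  by rewrite [mdeg _]md ltnNge ge.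
rewrite mul0r big1 // => i _; rewrite ifF //; apply/eqP => ie; have := ltn_ord i; lia.
Qed.

Lemma form_ideal_pihomog G e p : forms G -> form_ideal G p -> form_ideal G (pihomog mdeg
  e p).
Proof.
elim: G p => [|x G IHG] p /=; first by move=> _ ->; rewrite raddf0.
move=> /forms_cons[x1 x2 fG] [a /(IHG _ fG)].
rewrite raddfB /= (pihomogM _ _ x2).
case: leqP => _ ?; first by exists (pihomog mdeg (e - x.1) a).
by exists 0; rewrite mul0r.
Qed.

Lemma form_ideal_homog_comp G p : (forall e, form_ideal G (pihomog mdeg e p)) ->
  form_ideal G p.
Proof.
move=> h; rewrite (pihomog_partitionE (leqnn (mmeasure mdeg p))).
by apply: (ideal_sum (form_ideal_ideal G)).
Qed.

Lemma dhomog_subspace (P : A -> Prop) e : ideal P -> subspace (fun v : S e => P (val v)).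
Proof.
by move=> idP; split=> [|u v Pu Pv|a v Pv] /=; [exact: ideal0 | exact: idealD |
  rewrite -mul_mpolyC; exact: idealMl].
Qed.

(** The choice is classical: ideals are predicates, and only their homogeneous
    parts have a dimension. *)
Definition part_of (P : A -> Prop) (idP : ideal P) e : {vspace S e} :=
  projT1 (cid (vspace_of_subspace (dhomog_subspace e idP))).

Lemma part_ofP P (idP : ideal P) e v : v \in part_of idP e <-> P (val v).
Proof. exact: (projT2 (cid (vspace_of_subspace (dhomog_subspace e idP)))). Qed.

Definition hilb G e : int :=
  (\dim {:S e})%:Z - (\dim (part_of (form_ideal_ideal G) e))%:Z.

Lemma hilb_eq G G' e : (forall p, form_ideal G p <-> form_ideal G' p) -> hilb G e = hilb
  G' e.
Proof.
move=> GG; rewrite /hilb; congr (_ - (\dim _)%:Z); apply/vspaceP => v.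
by apply/idP/idP => /part_ofP h; apply/part_ofP/GG.
Qed.

Lemma colon_ideal G g : ideal (fun q => form_ideal G (q * g)).
Proof.
split=> [|p q pI qI|p q qI]; first by rewrite mul0r; exact: ideal0 (form_ideal_ideal G).
  by rewrite mulrDl; exact: (idealD (form_ideal_ideal G)).
by rewrite -mulrA; exact: (idealMl (form_ideal_ideal G)).
Qed.

(** The dimension of [((I : g) / I)_e], zero in all degrees exactly when [g] is
    a nonzerodivisor modulo [I]. *)
Definition nullity G g e : nat :=
  (\dim (part_of (colon_ideal G g) e) - \dim (part_of (form_ideal_ideal G) e))%N.

Lemma part_of_colonS G g e :
  (part_of (form_ideal_ideal G) e <= part_of (colon_ideal G g) e)%VS.
Proof.
apply/subvP => v /part_ofP vI; apply/part_ofP; exact: (idealMr (form_ideal_ideal G)).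
Qed.

Definition mul_form g a b (q : S a) : S b := DHomog (pihomogP mdeg b (val q * g)).

Lemma mul_form_linear g a b : linear (@mul_form g a b).
Proof. by move=> c p q; apply/val_inj; rewrite /= mulrDl -scalerAl linearP. Qed.

HB.instance Definition _ g a b :=
  GRing.isLinear.Build K (S a) (S b) _ (@mul_form g a b) (@mul_form_linear g a b).

Lemma val_mul_form g d e (q : S (e - d)) : (d <= e)%N -> g \is d.-homog ->
  val (mul_form g e q) = val q * g.
Proof.
move=> de gd; rewrite /= pihomog_dE // -[X in X.-homog](subnK de).
by apply: dhomogM => //; exact: dhomog_is_dhomog.
Qed.

(** Exactness of [0 -> ((I : g) / I) -> A / I -> A / I -> A / (I + (g)) -> 0]. *)
Lemma hilb_cons x G e : forms (x :: G) ->
  hilb (x :: G) e =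
  hilb G e - (if (x.1 <= e)%N then hilb G (e - x.1) - (nullity G x.2 (e - x.1))%:Z else
    0).
Proof.
move=> /forms_cons[d0 gd fG]; set d := x.1 in d0 gd *; set g := x.2 in gd *.
have sub_cons p : form_ideal G p -> form_ideal (x :: G) p.
  by apply: gen_ideal_sub => y; rewrite inE => ->; rewrite orbT.
have g_cons : form_ideal (x :: G) g by apply: gen_ideal_mem; rewrite mem_head.
case: leqP => [de|ed]; last first.
  rewrite subr0 /hilb; congr (_ - (\dim _)%:Z); apply/vspaceP => v.
  apply/idP/idP => /part_ofP h; apply/part_ofP; last exact: sub_cons.
  case: h => a /(form_ideal_pihomog e fG); rewrite raddfB /= (pihomogM _ _ gd).
  by rewrite leqNgt ed subr0 pihomog_dE //; exact: dhomog_is_dhomog.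
pose I := part_of (form_ideal_ideal G) e.
pose C := part_of (colon_ideal G g) (e - d).
pose mu : 'Hom(S (e - d), S e) := linfun (mul_form g e).
have muE (q : S (e - d)) : val (mu q) = val q * g by rewrite lfunE val_mul_form.
have IE : part_of (form_ideal_ideal (x :: G)) e = (I + mu @: fullv)%VS.
  apply/vspaceP => v; apply/idP/idP.
    move=> /part_ofP[a /(form_ideal_pihomog e fG)];
      rewrite raddfB /= (pihomogM _ _ gd) de.
    rewrite pihomog_dE; last exact: dhomog_is_dhomog.
    move=> h; pose q : S (e - d) := DHomog (pihomogP mdeg (e - d) a).
    rewrite -(subrK (mu q) v) memv_add ?memv_img ?memvf //.
    by apply/part_ofP; rewrite raddfB /= muE.
  case/memv_addP => u /part_ofP uI [_ /memv_imgP[q _ ->] ->]; apply/part_ofP.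
  rewrite raddfD /= muE; apply: (idealD (form_ideal_ideal _)); first exact: sub_cons.
  exact: (idealMl (form_ideal_ideal _)).
have capE : (I :&: mu @: fullv)%VS = (mu @: C)%VS.
  apply/vspaceP => v; apply/idP/idP.
    rewrite memv_cap => /andP[/part_ofP vI /memv_imgP[q _ vq]].
    by rewrite vq memv_img //; apply/part_ofP; rewrite -muE -vq.
  move=> /memv_imgP[q /part_ofP qC ->]; rewrite memv_cap memv_img ?memvf // andbT.
  by apply/part_ofP; rewrite muE.
have kerC : (lker mu <= C)%VS.
  apply/subvP => q; rewrite memv_ker => /eqP q0; apply/part_ofP.
  by rewrite -muE q0 /=; exact: ideal0 (form_ideal_ideal G).
have dI := dimv_sum_cap I (mu @: fullv)%VS; rewrite -IE capE in dI.
have := limg_ker_dim mu fullv; rewrite (capv_idPr (subvf _)) => dF.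
have := limg_ker_dim mu C; rewrite (capv_idPr kerC) => dC.
have := dimvS (part_of_colonS G g (e - d)); rewrite -/C => IC.
rewrite /hilb /nullity -/C; move: dI dF dC IC; rewrite -/I.
move: (\dim {:S e}) (\dim {:S (e - d)}) (\dim C) (\dim I) (\dim (part_of _ (e - d))) => a
  b c i i'.
by move: (\dim _) (\dim _) (\dim _) (\dim _) => a1 a2 a3 a4; lia.
Qed.

End HilbertFunction.

(** * Regular sequences of forms *)

Section RegularForms.
Variables (n : nat) (K : fieldType).
Local Notation A := {mpoly K[n.+1]}.
Implicit Types (p q g : A) (G : seq (nat * A)).

(** For forms of positive degrees, having the Hilbert function of a complete
    intersection characterises regular sequences, in a form that does not
    depend on their order. *)
Definition regular_forms G := forall e, hilb G e = hilb_seq n.+1 (map fst G) e.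

Definition nonzerodivisor_mod G g := forall q, form_ideal G (q * g) -> form_ideal G q.

Lemma hilb_nil e : hilb ([::] : seq (nat * A)) e = hilb_seq n.+1 [::] e.
Proof.
rewrite hilb_seq_nil geom_coefE /hilb.
have -> : part_of (form_ideal_ideal ([::] : seq (nat * A))) e = 0%VS.
  apply/vspaceP => v; rewrite memv0; apply/idP/idP => [/part_ofP v0|/eqP->].
    exact/eqP/val_inj.
  by rewrite mem0v.
by rewrite dimv0 subr0 dimvf.
Qed.

Lemma hilb_cons_ge x G e : forms (x :: G) ->
  hilb G e - (if (x.1 <= e)%N then hilb G (e - x.1) else 0) <= hilb (x :: G) e.
Proof. by move=> fG; rewrite hilb_cons //; case: ifP => // _; lia. Qed.

(** Adding a form of degree [d] subtracts from the Hilbert function at most its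
    shift by [d], and before a first deviation this shift is the expected one. *)
Lemma hilb_ge G e : forms G ->
  (forall e', (e' < e)%N -> hilb G e' = hilb_seq n.+1 (map fst G) e') ->
  hilb_seq n.+1 (map fst G) e <= hilb G e.
Proof.
elim: G e => [|x G IHG] e; first by rewrite /= hilb_nil.
move=> fxG; have [x0 _ fG] := forms_cons fxG => agree.
suff agreeG e' : (e' < e)%N -> hilb G e' = hilb_seq n.+1 (map fst G) e'.
  have := hilb_cons_ge e fxG; have := IHG e fG agreeG; rewrite /= hilb_seq_cons.
  by case: leqP => xe; rewrite ?(agreeG (e - x.1)%N); lia.
elim/ltn_ind: e' => e' IHe' e'e.
have agree' e'' : (e'' < e')%N -> hilb G e'' = hilb_seq n.+1 (map fst G) e''.
  by move=> h; apply: IHe' => //; apply: ltn_trans e'e.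
have := hilb_cons_ge e' fxG; have := IHG e' fG agree'.
rewrite agree //= hilb_seq_cons; case: leqP => xe; rewrite ?(agree' (e' - x.1)%N); lia.
Qed.

(** An excess of [G] in some degree would be one of [x :: G] in the same
    degree, the first deviations being excesses. *)
Lemma regular_forms_behead x G : forms (x :: G) -> regular_forms (x :: G) ->
  regular_forms G.
Proof.
move=> fxG rxG; have [x0 _ fG] := forms_cons fxG; elim/ltn_ind => e IHe.
have := hilb_cons_ge e fxG; have := hilb_ge fG IHe.
rewrite rxG /= hilb_seq_cons; case: leqP => xe; rewrite ?(IHe (e - x.1)%N); lia.
Qed.

(** Both Hilbert functions being the expected ones, [hilb_cons] leaves no room
    for a kernel of the multiplication by [x]. *)
Lemma regular_forms_nzd x G : forms (x :: G) -> regular_forms (x :: G) ->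
  nonzerodivisor_mod G x.2.
Proof.
move=> fxG rxG q; have [x0 xd fG] := forms_cons fxG.
have rG := regular_forms_behead fxG rxG.
move=> qI; apply: form_ideal_homog_comp => e.
have nul : nullity G x.2 e = 0%N.
  have := hilb_cons (e + x.1) fxG.
  rewrite rxG !rG /= hilb_seq_cons leq_addl addnK; lia.
have /eqP EI : part_of (form_ideal_ideal G) e == part_of (colon_ideal G x.2) e.
  by rewrite eqEdim part_of_colonS -subn_eq0 -/(nullity _ _ _) nul.
pose v : dhomog n.+1 K e := DHomog (pihomogP mdeg e q).
have /part_ofP // : v \in part_of (form_ideal_ideal G) e.
rewrite EI; apply/part_ofP => /=.
have := form_ideal_pihomog (e + x.1) fG qI.
by rewrite (pihomogM _ _ xd) leq_addl addnK.
Qed.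

Lemma regular_forms_cons x G : forms (x :: G) -> regular_forms G ->
  nonzerodivisor_mod G x.2 -> regular_forms (x :: G).
Proof.
move=> fxG rG nzd e; rewrite hilb_cons //= hilb_seq_cons !rG.
case: leqP => // xe; congr (_ - _).
rewrite /nullity (_ : part_of (colon_ideal G x.2) (e - x.1) = part_of (form_ideal_ideal
  G) (e - x.1)).
  by rewrite subnn subr0.
apply/eqP; rewrite eqEsubv part_of_colonS andbT; apply/subvP => v /part_ofP vI.
exact/part_ofP/nzd.
Qed.

Lemma form_ideal_perm G G' p : perm_eq G G' -> form_ideal G p <-> form_ideal G' p.
Proof.
move=> GG; split; apply: gen_ideal_sub => g; by rewrite (perm_mem (perm_map snd GG)).
Qed.

Lemma regular_forms_perm G G' : perm_eq G G' -> regular_forms G -> regular_forms G'.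
Proof.
move=> GG rG e; rewrite -(hilb_seq_perm _ _ (perm_map fst GG)) -rG.
by apply: hilb_eq => p; split=> /(form_ideal_perm _ GG).
Qed.

Lemma forms_perm G G' : perm_eq G G' -> forms G -> forms G'.
Proof. by move=> GG fG x; rewrite -(perm_mem GG); apply: fG. Qed.

(** If [q g] is zero modulo the ideal, so is [q l^N = q h g]. *)
Lemma nonzerodivisor_dvd G g l N h :
  nonzerodivisor_mod G l -> form_ideal G (l ^+ N - h * g) -> nonzerodivisor_mod G g.
Proof.
move=> nzl lhg q qg.
suff : form_ideal G (q * l ^+ N).
  elim: N {lhg} => [|N IHN]; first by rewrite mulr1.
  by rewrite exprSr mulrA => /nzl.
have -> : q * l ^+ N = q * (l ^+ N - h * g) + h * (q * g) by ring.
by apply: (idealD (form_ideal_ideal G)); apply: (idealMl (form_ideal_ideal G)).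
Qed.

End RegularForms.

(** * Forms without common zeros *)

(** The coefficients are a point where the product of the forms dual to the
    [z i] does not vanish. *)
Lemma linear_form_avoiding n (K : closedFieldType) s (z : nat -> 'I_n -> K) :
  (forall i, (i < s)%N -> exists j, z i j != 0) ->
  exists2 l : {mpoly K[n]}, l \is 1.-homog & forall i, (i < s)%N -> l.@[z i] != 0.
Proof.
move=> z0.
pose dual (a : 'I_n -> K) : {mpoly K[n]} := \sum_j a j *: 'X_j.
have dualE a b : (dual a).@[b] = \sum_j a j * b j.
  by rewrite (raddf_sum (meval b)); apply: eq_bigr => j _; rewrite /= mevalZ mevalXU.
have p0 : \prod_(i < s) dual (z i) != 0.
  rewrite prodf_seq_neq0; apply/allP => i _ /=; have [j zj] := z0 i (ltn_ord i).
  apply: contraNneq zj => di0; have := dualE (z i) (fun j' => (j' == j)%:R).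
  rewrite di0 meval0 (bigD1 j) //= eqxx mulr1 big1 ?addr0 => [<-//|j' /negPf->].
  by rewrite mulr0.
have [a] := mpoly_nonzero_point p0.
rewrite rmorph_prod prodf_seq_neq0 => /allP na.
exists (dual a); first by apply: rpred_sum => j _; rewrite rpredZ // dhomogX /= mdeg1.
move=> i si; have := na (Ordinal si) (mem_index_enum _); rewrite /= !dualE.
by under eq_bigr do rewrite mulrC.
Qed.

Section FormZeros.
Variables (n : nat) (K : fieldType).
Local Notation A := {mpoly K[n.+1]}.
Implicit Types (p q g l : A) (G : seq (nat * A)) (v z : 'I_n.+1 -> K).

Definition form_zero G v := forall x, x \in G -> x.2.@[v] = 0.

Definition only_trivial_zero G := forall v, form_zero G v -> forall i, v i = 0.

Lemma form_ideal_zero G v p : form_zero G v -> form_ideal G p -> p.@[v] = 0.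
Proof.
move=> Gv; apply: (gen_ideal_min (I := fun p => p.@[v] = 0)) => [|g /mapP[x xG ->]];
  last exact: Gv.
split=> [|q r q0 r0|q r r0]; first exact: meval0.
  by rewrite mevalD q0 r0 addr0.
by rewrite mevalM r0 mulr0.
Qed.

Lemma form_ideal_mem G x : x \in G -> form_ideal G x.2.
Proof. by move=> xG; apply: gen_ideal_mem; apply: map_f. Qed.

Lemma meval_homog0 d p v : (0 < d)%N -> p \is d.-homog -> (forall i, v i = 0) -> p.@[v] =
  0.
Proof.
move=> d0 pd v0; have -> : p.@[v] = p.@[fun i => 0 * v i].
  by apply: meval_eq => i; rewrite v0 mulr0.
by rewrite (meval_dhomogZ _ _ pd) expr0n gtn_eqF // mul0r.
Qed.

End FormZeros.

Section FormsWithoutZeros.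
Variables (n : nat) (K : closedFieldType).
Local Notation A := {mpoly K[n.+1]}.
Implicit Types (p q g l : A) (G : seq (nat * A)) (v z : 'I_n.+1 -> K).

Lemma form_nullstellensatz G p :
  (forall v, form_zero G v -> p.@[v] = 0) -> exists N, form_ideal G (p ^+ N).
Proof.
move=> pZ; apply: (nullstellensatz (form_ideal_ideal G)) => v vZ; apply: pZ => x xG.
exact/vZ/form_ideal_mem.
Qed.

(** If adding [x] leaves no zero, the quotient by [G] is finitely generated
    over [K[x]], so its Hilbert function is bounded. *)
Lemma bounded_hilb x G : forms (x :: G) -> only_trivial_zero (x :: G) ->
  exists T : finType, forall e, exists u : T -> A, forall q, q \is e.-homog ->
    exists c : T -> K, form_ideal G (q - \sum_m c m *: u m).
Proof.
move=> fxG xG0; have [d0 xd fG] := forms_cons fxG; set d := x.1 in d0 xd;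
  set g := x.2 in xd.
have [|C codim] := @finite_zeros_codim n.+1 K (form_ideal (x :: G)) [:: fun=> 0]
  (form_ideal_ideal _).
  move=> v vZ; exists (fun=> 0); first by left.
  by apply: xG0 => y yG; apply/vZ/form_ideal_mem.
(* in degree [e] each monomial can be completed by at most one power of [g] *)
exists {: 'X_{1..n.+1 < C}} => e.
pose u e (m : 'X_{1..n.+1 < C}) : A :=
  if (mdeg m <= e)%N && (d %| e - mdeg m)%N then g ^+ ((e - mdeg m) %/ d) * 'X_[m] else 0.
exists (u e).
pose good e q := exists c, form_ideal G (q - \sum_m c m *: u e m).
have goodD e' p q : good e' p -> good e' q -> good e' (p + q).
  move=> [c cI] [c' cI']; exists (fun m => c m + c' m).
  under eq_bigr do rewrite scalerDl.
  by rewrite big_split opprD addrACA; apply: (idealD (form_ideal_ideal G)).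
have goodZ e' a p : good e' p -> good e' (a *: p).
  move=> [c cI]; exists (fun m => a * c m).
  under eq_bigr do rewrite -scalerA.
  rewrite -scaler_sumr -scalerBr -mul_mpolyC; exact: (idealMl (form_ideal_ideal G)).
have goodI e' p : form_ideal G p -> good e' p.
  by move=> pI; exists (fun=> 0); rewrite big1 ?subr0 // => m _; rewrite scale0r.
have good0 e' : good e' 0 by apply: goodI; exact: ideal0 (form_ideal_ideal G).
have goodu e' m : good e' (u e' m).
  exists (fun m' => (m' == m)%:R); rewrite (bigD1 m) //= eqxx scale1r big1.
    by rewrite addr0 subrr; exact: ideal0 (form_ideal_ideal G).
  by move=> m' /negPf->; rewrite scale0r.
have good_lin e' (I : Type) (s : seq I) (Q : pred I) c (F : I -> A) :
    (forall i, Q i -> good e' (F i)) -> good e' (\sum_(i <- s | Q i) c i *: F i).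
  by move=> gF; apply: big_ind => // [|i Qi]; [exact: goodD | exact/goodZ/gF].
suff main e' q : q \is e'.-homog -> good e' q by move=> q; apply: main.
elim/ltn_ind: e' q => e' IHe q qe.
have [r szr [a aI]] := codim q.
have := form_ideal_pihomog e' fG aI.
rewrite !raddfB /= pihomog_dE // (pihomogM _ _ xd) => {}aI.
set ax := (if _ then _ else _) in aI.
have -> : q = (q - pihomog mdeg e' r - ax) + (pihomog mdeg e' r + ax).
  by ring.
apply: (goodD); first exact: goodI.
apply: (goodD).
  rewrite (pihomogwE _ _ szr); apply: (good_lin) => m /eqP me.
  have -> : 'X_[m] = u e' m :> A; last exact: goodu.
  by rewrite /u [mdeg m]me leqnn subnn dvdn0 div0n expr0 mul1r.
rewrite /ax; case: leqP => // de.
have [c cI] := IHe (e' - d)%N (ltac:(lia)) _ (pihomogP mdeg (e' - d) a).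
set s := \sum_m _ in cI.
have -> : pihomog mdeg (e' - d) a * g = g * (pihomog mdeg (e' - d) a - s) + g * s by ring.
apply: (goodD); first by apply/goodI/(idealMl (form_ideal_ideal G)).
rewrite /s mulr_sumr; under eq_bigr do rewrite -scalerAr.
apply: (good_lin) => m _.
suff : g * u (e' - d)%N m = u e' m \/ g * u (e' - d)%N m = 0.
  by case=> ->; [exact: goodu | exact: good0].
rewrite {1 3}/u; case: ifP => [/andP[me dm]|]; last by right; rewrite mulr0.
left; rewrite /u.
have eE : (e' - mdeg m = (e' - d - mdeg m) + d)%N by lia.
by rewrite eE dvdn_addl // dm divnDr // divnn d0 addn1 exprS mulrA (_ : (mdeg m <= e')%N)
  //; lia.
Qed.

(** Otherwise each linear form would vanish at a zero of [G]; choosing linear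
    forms that avoid the zeros found before gives arbitrarily many zeros on
    distinct lines, which forms of large degree separate. *)
Lemma linear_parameter x G : forms (x :: G) -> only_trivial_zero (x :: G) ->
  exists2 l, l \is 1.-homog & only_trivial_zero ((1%N, l) :: G).
Proof.
move=> fxG xG0; apply: contrapT => nol.
have bad l : l \is 1.-homog -> exists2 z, form_zero G z & l.@[z] = 0 /\ exists i, z i !=
  0.
  move=> l1; apply: contrapT => noz; apply: nol; exists l; first exact: l1.
  move=> v vZ i.
  apply/eqP/negPn/negP => vi; apply: noz; exists v.
    by move=> y yG; apply: vZ; rewrite inE yG orbT.
  by split; [apply: (vZ (1%N, l)); rewrite mem_head | exists i].
have chain s : exists (z : nat -> 'I_n.+1 -> K) (l : nat -> A),
    forall i, (i < s)%N -> [/\ form_zero G (z i), exists j, z i j != 0, (l i).@[z i] = 0,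
      l i \is 1.-homog & forall j, (j < i)%N -> (l i).@[z j] != 0].
  elim: s => [|s [z [l zl]]]; first by exists (fun _ _ => 0), (fun=> 0).
  have [|ls ls1 lsz] := @linear_form_avoiding _ _ s z.
    by move=> i /zl[].
  have [zs zsZ [lszs zs0]] := bad ls ls1.
  exists (fun i => if i == s then zs else z i), (fun i => if i == s then ls else l i) =>
    i.
  rewrite ltnS leq_eqVlt => /orP[/eqP->|si].
    by rewrite eqxx; split=> // j js; rewrite ltn_eqF // lsz.
  have [zi1 zi2 zi3 zi4 zi5] := zl i si.
  rewrite (ltn_eqF si); split=> // j ji; rewrite ltn_eqF ?zi5 //; exact: ltn_trans si.
have [T /(_ #|T|)[u span]] := bounded_hilb fxG xG0.
have [z [l zl]] := chain #|T|.+1.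
have [|l0 l01 l0z] := @linear_form_avoiding _ _ #|T|.+1 z.
  by move=> i /zl[].
(* [h i] vanishes at [z j] for [j > i] but not at [z i] *)
pose h (i : 'I_#|T|.+1) : A := l0 ^+ i * \prod_(i.+1 <= j < #|T|.+1) l j.
have hom_h i : h i \is #|T|.-homog.
  have hom_prod r : {subset r <= gtn #|T|.+1} -> \prod_(j <- r) l j \is (size r).-homog.
    elim: r => [|j r IHr] rT; first by rewrite big_nil dhomog1.
    rewrite big_cons; apply: (@dhomogM _ _ _ 1 _ (size r)).
      by have [] := zl j (rT j (mem_head _ _)).
    by apply: IHr => j' j'r; apply: rT; rewrite inE j'r orbT.
  have -> : #|T| = (1 * i + (#|T|.+1 - i.+1))%N by have := ltn_ord i; lia.
  apply: dhomogM; first exact: dhomogMn.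
  rewrite -[X in X.-homog](size_iota i.+1); apply: hom_prod => j.
  by rewrite mem_index_iota => /andP[].
have : (#|{: 'I_#|T|.+1}| <= #|T|)%N; last by rewrite card_ord ltnn.
apply: (leq_card_indep (ideal_subspace (form_ideal_ideal G)) (u := h) (v := u)) => [i|c
  cI i].
  exact/span/hom_h.
have [m] := ubnP (#|T| - i)%N; elim: m i => // m IHm i im.
have [ziZ _ _ _ _] := zl i (ltn_ord i).
have := form_ideal_zero ziZ cI; rewrite (raddf_sum (meval (z i))) (bigD1 i) //= mevalZ.
rewrite big1 ?addr0 => [|j ji]; last first.
  rewrite mevalZ; have [ij|] := ltnP i j; first rewrite IHm ?mul0r //.
    apply: leq_trans (ltn_sub2l _ ij) _; last by rewrite -ltnS.
    by apply: leq_trans ij _; rewrite -ltnS.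
  rewrite leq_eqVlt val_eqE (negPf ji) /= => lt_ji.
  rewrite /h mevalM rmorph_prod (bigD1_seq (i : nat)) ?iota_uniq ?mem_index_iota ?lt_ji
    ?ltn_ord //=.
  by have [_ _ -> _ _] := zl i (ltn_ord i); rewrite mul0r !mulr0.
move/eqP; rewrite mulf_eq0 => /orP[/eqP//|]; rewrite /h mevalM mulf_eq0 rmorphXn /=.
rewrite expf_eq0 (negPf (l0z i (ltn_ord i))) andbF /= rmorph_prod.
rewrite prodf_seq_eq0 => /hasP[j]; rewrite mem_index_iota /= => /andP[ij js].
by have [_ _ _ _ /(_ i ij)/negPf->] := zl j js.
Qed.

Lemma dhomog1E p : p \is 1.-homog -> p = \sum_i p@_U_(i) *: 'X_i.
Proof.
move=> p1; apply/mpolyP => m; rewrite (raddf_sum (mcoeff m)) /=.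
have [/mdeg1P[i /eqP->]|m1] := boolP (mdeg m == 1%N).
  rewrite (bigD1 i) //= mcoeffZ mcoeffX eqxx mulr1 big1 ?addr0 // => j ji.
  by rewrite mcoeffZ mcoeffX eq_mnm1 (negPf ji) mulr0.
rewrite (dhomog_nemf_coeff p1 m1) big1 // => i _; rewrite mcoeffZ mcoeffX.
by case: (U_(i)%MM =P m) m1 => [<-|_ _]; rewrite ?mdeg1 // mulr0.
Qed.

(** The matrix of coefficients is invertible, so the ideal contains every
    variable. *)
Lemma linear_forms_regular G : forms G -> size G = n.+1 -> all (fun x => x.1 == 1%N) G ->
  only_trivial_zero G -> regular_forms G.
Proof.
move=> fG szG G1 G0.
have mapG : map fst G = nseq n.+1 1%N.
  have /all_pred1P : all (pred1 1%N) (map fst G) by rewrite all_map.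
  by rewrite size_map szG.
pose g a := (nth (0%N, 0) G a).2.
have inG (a : 'I_n.+1) : nth (0%N, 0) G a \in G by rewrite mem_nth ?szG.
have g1 (a : 'I_n.+1) : g a \is 1.-homog.
  by have [_] := fG _ (inG a); rewrite (eqP (allP G1 _ (inG a))).
pose M := \matrix_(a < n.+1, i < n.+1) (g a)@_U_(i).
have gE (a : 'I_n.+1) : g a = \sum_i M a i *: 'X_i.
  by rewrite {1}(dhomog1E (g1 a)); apply: eq_bigr => i _; rewrite mxE.
have Mu : M \in unitmx.
  rewrite -unitmx_tr -row_free_unit -kermx_eq0;
    apply/negPn/negP => /rowV0Pn[v /sub_kermxP vM].
  case/rV0Pn => i /eqP; apply; apply: G0 => x xG.
  have ia : (index x G < n.+1)%N by rewrite -[X in (_ < X)%N]szG index_mem.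
  have -> : x.2 = g (Ordinal ia) by rewrite /g /= nth_index.
  rewrite gE (raddf_sum (meval _)) /=.
  have := congr1 (fun w : 'rV_n.+1 => w 0 (Ordinal ia)) vM; rewrite !mxE => vMa.
  rewrite -[RHS]vMa.
  by apply: eq_bigr => j _; rewrite mevalZ mevalXU !mxE mulrC.
have XI i : form_ideal G 'X_i.
  have -> : 'X_i = \sum_a (invmx M i a)%:MP * g a.
    under eq_bigr => a _ do rewrite gE mulr_sumr.
    rewrite exchange_big /= (bigD1 i) //= [X in X + _](_ : _ = 'X_i).
      rewrite big1 ?addr0 // => j ji; under eq_bigr do rewrite mul_mpolyC scalerA.
      have := congr1 (fun w : 'M_n.+1 => w i j) (mulVmx Mu);
        rewrite !mxE eq_sym (negPf ji) => ij.
      by rewrite -scaler_suml ij scale0r.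
    under eq_bigr do rewrite mul_mpolyC scalerA.
    have := congr1 (fun w : 'M_n.+1 => w i i) (mulVmx Mu); rewrite !mxE eqxx => ii.
    by rewrite -scaler_suml ii scale1r.
  apply: (ideal_sum (form_ideal_ideal G)) => a _; apply: (idealMl (form_ideal_ideal G)).
  exact/form_ideal_mem/inG.
move=> e; rewrite mapG hilb_seq_nseq1 /hilb; case: e => [|e].
  have -> : part_of (form_ideal_ideal G) 0 = 0%VS.
    apply/vspaceP => v; rewrite memv0; apply/idP/idP => [/part_ofP vI|/eqP->];
      last by rewrite mem0v.
    have vC : val v = ((val v)@_0)%:MP.
      apply: msize1_polyC; apply: msize_dhomog; exact: dhomog_is_dhomog.
    have /form_ideal_zero/(_ vI) : form_zero G (fun=> 0).
      by move=> x xG; have [x0 xd] := fG _ xG; apply: meval_homog0 xd _.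
    by rewrite vC mevalC => v0; apply/eqP/val_inj; rewrite vC v0 /= rmorph0.
  by rewrite dimv0 dimvf subr0 /= /dim /= bin0.
have -> : part_of (form_ideal_ideal G) e.+1 = fullv.
  apply/vspaceP => v; rewrite memvf; apply/part_ofP.
  rewrite (mpolyE (val v)) big_seq; apply: (ideal_sum (form_ideal_ideal G)) => m mv.
  have me : mdeg m = e.+1 by apply: (dhomogP _ _ _ (dhomog_is_dhomog v)).
  have [i mi] : exists i, m i != 0%N.
    apply: contrapT => noi; move: me; rewrite mdegE big1 // => i _.
    by apply/eqP/negPn/negP => mi; apply: noi; exists i.
  rewrite -mul_mpolyC; apply: (idealMl (form_ideal_ideal G)).
  rewrite -(submK (m := U_(i)%MM) (m' := m)) ?lep1mP // mpolyXD.
  exact: (idealMl (form_ideal_ideal G)).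
by rewrite subrr.
Qed.

(** A form [x] of degree at least two is exchanged for a linear form [l] with
    the same property. By induction [l] is a nonzerodivisor modulo the other
    forms, and by the Nullstellensatz a power of [l] is a multiple of [x] modulo
    these, so that [x] is a nonzerodivisor as well. *)
Theorem only_trivial_zero_regular G : forms G -> size G = n.+1 -> only_trivial_zero G ->
  regular_forms G.
Proof.
have [m] := ubnP (count (fun x => x.1 != 1%N) G); elim: m G => // m IHm G cG fG szG G0.
have [/(linear_forms_regular fG szG)/(_ G0)//|] := boolP (all (fun x => x.1 == 1%N) G).
rewrite -has_predC => /hasP[x xG /= x1].
have Gx := perm_to_rem xG; set G' := rem x G in Gx.
have fxG := forms_perm Gx fG.
have xG0 : only_trivial_zero (x :: G').
  by move=> v vZ; apply: G0 => y yG; apply: vZ; rewrite -(perm_mem Gx).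
have [l l1 lG0] := linear_parameter fxG xG0.
have [x0 xd fG'] := forms_cons fxG.
have flG : forms ((1%N, l) :: G') by move=> y; rewrite inE => /orP[/eqP->|/fG'].
have rlG : regular_forms ((1%N, l) :: G').
  apply: (IHm _ _ flG _ lG0); last by rewrite -[RHS]szG (perm_size Gx).
  by move: cG; rewrite (permP Gx) /= x1 add1n ltnS.
have xG' : perm_eq (x :: G') G by rewrite perm_sym.
apply: (regular_forms_perm xG').
apply: (regular_forms_cons fxG (regular_forms_behead flG rlG)).
have [|N [h lN]] := @form_nullstellensatz (x :: G') l.
  by move=> v /xG0; apply: meval_homog0 l1.
exact: nonzerodivisor_dvd (regular_forms_nzd flG rlG) lN.
Qed.

End FormsWithoutZeros.

(** * Homogenisation *)

Section Homogenisation.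
Variables (n : nat) (K : fieldType).
Implicit Types (p : {mpoly K[n]}) (q : {mpoly K[n.+1]}) (v : 'I_n -> K) (a : 'X_{1..n}).

(** The last variable is the homogenising one. *)
Definition hom_mnm m a : 'X_{1..n.+1} :=
  [multinom if unlift ord_max i is Some j then a j else (m - mdeg a)%N | i < n.+1].

Definition homogenise m p : {mpoly K[n.+1]} := \sum_(a <- msupp p) p@_a *: 'X_[hom_mnm m
  a].

Lemma mdeg_lift_max (b : 'X_{1..n.+1}) : (mdeg b = b ord_max + \sum_j b (lift ord_max
  j))%N.
Proof. by rewrite mdegE (bigD1_ord ord_max). Qed.

Lemma mdeg_hom_mnm m a : (mdeg a <= m)%N -> mdeg (hom_mnm m a) = m.
Proof.
move=> am; rewrite mdeg_lift_max mnmE unlift_none.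
under eq_bigr do rewrite mnmE liftK.
by rewrite -mdegE subnK.
Qed.

Lemma homogenise_homog m p : (msize p <= m.+1)%N -> homogenise m p \is m.-homog.
Proof.
move=> pm; rewrite /homogenise big_seq; apply: rpred_sum => a ap; rewrite rpredZ //.
rewrite dhomogX /= mdeg_hom_mnm //.
by rewrite -ltnS; apply: leq_trans pm; apply: msize_mdeg_lt.
Qed.

Lemma meval_extend_pt (b : 'X_{1..n.+1}) v t :
  ('X_[b] : {mpoly K[n.+1]}).@[extend_pt v t] =
  t ^+ b ord_max * \prod_j v j ^+ b (lift ord_max j).
Proof.
rewrite mevalX (bigD1_ord ord_max) //= /extend_pt unlift_none; congr (_ * _).
by apply: eq_bigr => j _; rewrite liftK.
Qed.

Lemma meval_hom_mnm m a v t :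
  ('X_[hom_mnm m a] : {mpoly K[n.+1]}).@[extend_pt v t] =
  t ^+ (m - mdeg a) * ('X_[a] : {mpoly K[n]}).@[v].
Proof.
rewrite meval_extend_pt mevalX mnmE unlift_none; congr (_ * _).
by apply: eq_bigr => j _; rewrite mnmE liftK.
Qed.

Lemma meval_homogenise1 m p v : (homogenise m p).@[extend_pt v 1] = p.@[v].
Proof.
rewrite (raddf_sum (meval _)) [in RHS](mpolyE p) (raddf_sum (meval _)).
by apply: eq_bigr => a _ /=; rewrite !mevalZ meval_hom_mnm expr1n mul1r.
Qed.

Lemma meval_homogenise0 m p v : (msize p <= m.+1)%N ->
  (homogenise m p).@[extend_pt v 0] = (pihomog mdeg m p).@[v].
Proof.
move=> pm; rewrite pihomogE !(raddf_sum (meval _)) [RHS]big_mkcond big_seq [RHS]big_seq.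
apply: eq_bigr => a ap /=; rewrite mevalZ meval_hom_mnm expr0n subn_eq0.
have am : (mdeg a <= m)%N by rewrite -ltnS; apply: leq_trans pm; apply: msize_mdeg_lt.
rewrite (_ : (m <= mdeg a)%N = (mdeg a == m)) 1?eqn_leq ?am //.
by case: ifP => _; rewrite ?mul1r ?mevalZ // mul0r mulr0.
Qed.

Definition dehomogenise q : {mpoly K[n]} :=
  \sum_(b <- msupp q) q@_b *: 'X_[[multinom b (lift ord_max j) | j < n]].

Lemma meval_dehomogenise q v : (dehomogenise q).@[v] = q.@[extend_pt v 1].
Proof.
rewrite (raddf_sum (meval _)) [in RHS](mpolyE q) (raddf_sum (meval _)).
apply: eq_bigr => b _ /=; rewrite !mevalZ meval_extend_pt expr1n mul1r mevalX.
by congr (_ * _); apply: eq_bigr => j _; rewrite mnmE.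
Qed.

Lemma msize_dehomogenise m q : q \is m.-homog -> (msize (dehomogenise q) <= m.+1)%N.
Proof.
move=> /dhomogP qm; apply: leq_trans (msize_sum _ _ _) _; apply/bigmax_leqP_seq => b bq _.
have bm : mdeg b = m by exact: qm.
apply: leq_trans (msizeZ_le _ _) _; rewrite msizeX ltnS -bm mdeg_lift_max mdegE.
by under eq_bigr do rewrite mnmE; rewrite leq_addl.
Qed.

End Homogenisation.

(** * Ideals of forms that vanish on a sufficient intersection *)

Section Quotient.
Variables (n : nat) (K : fieldType).
Implicit Type G : seq (nat * {mpoly K[n.+1]}).

Lemma quotient_basis G e : exists (d : nat) (b : 'I_d -> {mpoly K[n.+1]}),
  [/\ d%:Z = hilb G e, forall i, b i \is e.-homog,
      forall c : 'I_d -> K, form_ideal G (\sum_i c i *: b i) -> forall i, c i = 0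
    & forall q, q \is e.-homog ->
        exists c : 'I_d -> K, form_ideal G (q - \sum_i c i *: b i)].
Proof.
pose I := part_of (form_ideal_ideal G) e.
pose B := vbasis (I^C)%VS.
exists (\dim (I^C)%VS), (fun i => val (tnth B i)); split.
- by rewrite dimv_compl /hilb -subzn ?dimvS ?subvf.
- by move=> i; apply: dhomog_is_dhomog.
- move=> c cI; have wE : val (\sum_i c i *: tnth B i) = \sum_i c i *: val (tnth B i).
    by rewrite raddf_sum.
  have w0 : \sum_i c i *: tnth B i = 0.
    apply/eqP; rewrite -memv0 -(capv_compl I) memv_cap; apply/andP; split.
      by apply/part_ofP; rewrite wE.
    by apply: memv_suml => i _; rewrite memvZ // vbasis_mem // mem_tnth.
  have /freeP/(_ c) : free B := basis_free (vbasisP _).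
  by apply; rewrite -[RHS]w0; apply: eq_bigr => i _; rewrite (tnth_nth 0).
move=> q qe; pose w : dhomog n.+1 K e := DHomog qe.
have : w \in (I + I^C)%VS by rewrite addv_complf memvf.
case/memv_addP => u uI [t tC wE].
exists (fun i => coord B i t).
have -> : q - \sum_i coord B i t *: val (tnth B i) = val u; last by move/part_ofP: uI.
have tE : val t = \sum_i coord B i t *: val (tnth B i).
  by rewrite {1}(coord_vbasis tC) raddf_sum; apply: eq_bigr => i _; rewrite (tnth_nth 0).
have -> : q = val u + val t by rewrite -raddfD -wE.
by rewrite -tE addrK.
Qed.

Lemma regular_forms_suffix H G : forms (H ++ G) -> regular_forms (H ++ G) ->
  regular_forms G.
Proof.
elim: H => // x H IHH fxHG /(regular_forms_behead fxHG); apply: IHH.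
by have [] := forms_cons fxHG.
Qed.

Definition homog_radical G := forall d p N, p \is d.-homog ->
  form_ideal G (p ^+ N) -> form_ideal G p.

(** If [p^N] is in the smaller ideal then [p = a x] modulo it, and [a^N] is in
    it because [x] is a nonzerodivisor; the degree of [a] is smaller. *)
Lemma homog_radical_behead x G : forms (x :: G) -> regular_forms (x :: G) ->
  homog_radical (x :: G) -> homog_radical G.
Proof.
move=> fxG rxG radx; have [x0 xd fG] := forms_cons fxG.
have nzd := regular_forms_nzd fxG rxG.
elim/ltn_ind => d IHd p N pd pN.
have [a] : form_ideal (x :: G) p.
  by apply: radx pd _; apply: gen_ideal_sub pN => y; rewrite inE => ->; rewrite orbT.
move=> /(form_ideal_pihomog d fG); rewrite raddfB /= pihomog_dE // (pihomogM _ _ xd).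
case: leqP => xd'; last by rewrite subr0.
set a' := pihomog _ _ a => paI.
have a'd : a' \is (d - x.1).-homog by exact: pihomogP.
suff a'I : form_ideal G a'.
  rewrite -(subrK (a' * x.2) p); apply: (idealD (form_ideal_ideal G) paI).
  exact: (idealMr (form_ideal_ideal G)).
apply: (IHd (d - x.1)%N _ a' N a'd); first by lia.
have red M : form_ideal G (a' ^+ N * x.2 ^+ M) -> form_ideal G (a' ^+ N).
  by elim: M => [|M IHM]; rewrite ?expr0 ?mulr1 // exprSr mulrA => /nzd/IHM.
apply: (red N); rewrite -exprMn -[X in form_ideal G X](subKr (p ^+ N)).
apply: (idealB (form_ideal_ideal G) pN); rewrite subrXX.
exact: (idealMr (form_ideal_ideal G)).
Qed.

Lemma homog_radical_suffix H G : forms (H ++ G) -> regular_forms (H ++ G) ->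
  homog_radical (H ++ G) -> homog_radical G.
Proof.
elim: H => // x H IHH fxHG rxHG /(homog_radical_behead fxHG rxHG); apply: IHH.
  by have [] := forms_cons fxHG.
exact: regular_forms_behead rxHG.
Qed.

End Quotient.

Section HomogenisedFamily.
Variables (n r : nat) (K : fieldType) (k : 'I_r -> nat) (f : 'I_r -> {mpoly K[n]}).
Hypothesis hyp_f : forall i, hypersurface (k i) (f i).

Definition homogenised_family : seq (nat * {mpoly K[n.+1]}) :=
  [seq (k i, homogenise (k i) (f i)) | i <- enum 'I_r].

Lemma hypersurface_msize i : (msize (f i) <= (k i).+1)%N.
Proof. by have /andP[_ /eqP->] := hyp_f i. Qed.

Lemma size_homogenised_family : size homogenised_family = r.
Proof. by rewrite size_map size_enum_ord. Qed.

Lemma degrees_homogenised_family : map fst homogenised_family = [seq k i | i <- enum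
  'I_r].
Proof. by rewrite -map_comp. Qed.

Lemma homogenised_family_forms : forms homogenised_family.
Proof.
move=> _ /mapP[i _ ->] /=; have /andP[k0 _] := hyp_f i; split=> //.
exact/homogenise_homog/hypersurface_msize.
Qed.

Lemma homogenised_family_zero1 v :
  form_zero homogenised_family (extend_pt v 1) <-> forall i, (f i).@[v] = 0.
Proof.
split=> [fv i|fv _ /mapP[i _ ->]] /=; last by rewrite meval_homogenise1.
rewrite -(meval_homogenise1 (k i)); apply: (fv (k i, homogenise (k i) (f i))).
by apply/mapP; exists i; rewrite ?mem_enum.
Qed.

Lemma homogenised_family_zero0 v :
  form_zero homogenised_family (extend_pt v 0) ->
  forall i, (pihomog mdeg (k i) (f i)).@[v] = 0.
Proof.
move=> fv i; rewrite -meval_homogenise0; last exact: hypersurface_msize.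
by apply: (fv (k i, homogenise (k i) (f i))); apply/mapP; exists i; rewrite ?mem_enum.
Qed.

End HomogenisedFamily.

Section SufficientIntersection.
Variables (n s : nat) (K : closedFieldType).
Variables (k : 'I_s -> nat) (f : 'I_s -> {mpoly K[n]}).
Variables (l : 'I_(n - s) -> nat) (g : 'I_(n - s) -> {mpoly K[n]}).
Variable pts : seq 'rV[K]_n.
Hypothesis le_sn : (s <= n)%N.
Hypothesis hyp_f : forall i, hypersurface (k i) (f i).
Hypothesis hyp_g : forall i, hypersurface (l i) (g i).
Hypothesis uniq_pts : uniq pts.
Hypothesis size_pts : size pts = ((\prod_i k i) * (\prod_i l i))%N.
Hypothesis ptsP : forall x, (x \in pts) = common_zero f x && common_zero g x.

Local Notation F := (homogenised_family k f).
Local Notation G := (homogenised_family l g).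
Local Notation x0 := (1%N, 'X_ord_max : {mpoly K[n.+1]}).

Let fF : forms F := homogenised_family_forms hyp_f.
Let fG : forms G := homogenised_family_forms hyp_g.

Lemma forms_all : forms (x0 :: G ++ F).
Proof.
move=> y; rewrite inE mem_cat => /orP[/eqP->|/orP[/fG//|/fF//]].
by split; rewrite // dhomogX /= mdeg1.
Qed.

Lemma extend_ptE (v : 'I_n.+1 -> K) t : v ord_max = t ->
  v =1 extend_pt (fun j => v (lift ord_max j)) t.
Proof. by move=> vt i; rewrite /extend_pt; case: unliftP => [j|] ->. Qed.

Lemma form_zero_eq (H : seq (nat * {mpoly K[n.+1]})) v w : v =1 w -> form_zero H v ->
  form_zero H w.
Proof. by move=> vw Hv y yH; rewrite -(meval_eq _ vw); apply: Hv. Qed.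

(** The form [x_n] leaves only zeros at infinity, which [no_zero_at_infinity]
    excludes. *)
Lemma all_only_trivial_zero : only_trivial_zero (x0 :: G ++ F).
Proof.
move=> v vZ; have vm : v ord_max = 0.
  by have := vZ x0 (mem_head _ _); rewrite mevalXU.
have vE := extend_ptE vm; set y := fun j => _ in vE.
have vF : form_zero F (extend_pt y 0).
  by apply: (form_zero_eq vE) => z zF; apply: vZ; rewrite inE mem_cat zF !orbT.
have vG : form_zero G (extend_pt y 0).
  by apply: (form_zero_eq vE) => z zG; apply: vZ; rewrite inE mem_cat zG orbT.
have e : n = (s + (n - s))%N by rewrite subnKC.
pose pick T (a : 'I_s -> T) (b : 'I_(n - s) -> T) (i : 'I_n) :=
  match split (cast_ord e i) with inl j => a j | inr j => b j end.
have prod_pick : (\prod_i pick _ k l i = (\prod_i k i) * (\prod_i l i))%N.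
  rewrite (reindex (cast_ord (esym e))) /=; last first.
    by exists (cast_ord e) => i _; rewrite ?cast_ordKV ?cast_ordK.
  rewrite big_split_ord /=; congr (_ * _)%N; apply: eq_bigr => i _;
    rewrite /pick cast_ordKV.
    by rewrite (unsplitK (inl i)).
  by rewrite (unsplitK (inr i)).
have y0 : forall j, y j = 0.
  apply: (@no_zero_at_infinity n K (pick _ f g) (pick _ k l) pts) => //.
  - move=> i; rewrite /pick; case: split => j; first by have /andP[] := hyp_f j.
    by have /andP[] := hyp_g j.
  - by move=> i; rewrite /pick; case: split => j; apply: hypersurface_msize.
  - by rewrite size_pts prod_pick.
  - move=> x; rewrite ptsP; apply/andP/forallP => [[/forallP xf /forallP xg] i|xfg].
      by rewrite /pick; case: split => j.
    split; apply/forallP => j.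
      by have := xfg (cast_ord (esym e) (lshift _ j));
        rewrite /pick cast_ordKV (unsplitK (inl j)).
    by have := xfg (cast_ord (esym e) (rshift _ j));
      rewrite /pick cast_ordKV (unsplitK (inr j)).
  - move=> i; rewrite /pick; case: split => j; exact: homogenised_family_zero0.
by move=> i; rewrite vE /extend_pt; case: unlift.
Qed.

Lemma all_regular : regular_forms (x0 :: G ++ F).
Proof.
apply: only_trivial_zero_regular forms_all _ all_only_trivial_zero.
by rewrite /= size_cat !size_homogenised_family subnK.
Qed.

Lemma regular_GF : regular_forms (G ++ F).
Proof. exact: regular_forms_behead forms_all all_regular. Qed.

Lemma forms_GF : forms (G ++ F).
Proof. by have [] := forms_cons forms_all. Qed.

Lemma pts_zero x : x \in pts -> form_zero (G ++ F) (extend_pt (x 0) 1).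
Proof.
rewrite ptsP => /andP[/forallP xf /forallP xg].
have zF : form_zero F (extend_pt (x 0) 1) by apply/homogenised_family_zero1 => i;
  apply/eqP.
have zG : form_zero G (extend_pt (x 0) 1) by apply/homogenised_family_zero1 => i;
  apply/eqP.
by move=> y; rewrite mem_cat => /orP[/zG|/zF].
Qed.

Lemma hilb_GF_le e : hilb (G ++ F) e <= (size pts)%:Z.
Proof.
rewrite regular_GF; apply: le_trans (hilb_seq_le _ _) _.
  by rewrite size_map size_cat !size_homogenised_family subnK.
by rewrite size_pts map_cat !degrees_homogenised_family big_cat !big_map -!enumT
  !big_enum mulnC.
Qed.

Lemma separating_form (x y : 'rV[K]_n) : x != y -> exists2 h : {mpoly K[n.+1]}, h \is
  1.-homog &
  h.@[extend_pt (x 0) 1] = 0 /\ h.@[extend_pt (y 0) 1] != 0.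
Proof.
move=> xy; have [j xyj] : exists j, x 0 j != y 0 j.
  apply: contrapT => noj; case/eqP: xy; apply/rowP => j.
  by apply/eqP/negPn/negP => h; apply: noj; exists j.
exists ('X_(lift ord_max j) - x 0 j *: 'X_ord_max).
  by rewrite rpredB ?rpredZ // dhomogX /= mdeg1.
split; rewrite mevalB mevalZ !mevalXU /extend_pt liftK unlift_none mulr1 ?subrr //.
by rewrite subr_eq0 eq_sym.
Qed.

(** For large degrees the points impose as many conditions on forms as the
    Hilbert function allows; [x_n] being a nonzerodivisor gives the others. *)
Lemma vanish_pts_ideal d p : p \is d.-homog ->
  (forall x, x \in pts -> p.@[extend_pt (x 0) 1] = 0) -> form_ideal (G ++ F) p.
Proof.
set D := size pts; move=> pd pZ.
pose q := p * 'X_ord_max ^+ D; pose m := (d + D)%N.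
have x1 : ('X_ord_max : {mpoly K[n.+1]}) \is 1.-homog by rewrite dhomogX /= mdeg1.
have qm : q \is m.-homog by apply: dhomogM => //; have := dhomogMn D x1; rewrite mul1n.
have qZ x : x \in pts -> q.@[extend_pt (x 0) 1] = 0 by move=> /pZ px;
  rewrite mevalM px mul0r.
suff : form_ideal (G ++ F) q.
  rewrite /q; elim: (D) => [|e IHe]; first by rewrite mulr1.
  by rewrite exprSr mulrA => /(regular_forms_nzd forms_all all_regular)/IHe.
have [t [b [tE _ _ span]]] := quotient_basis (G ++ F) m.
pose pt (i : 'I_D) := extend_pt (nth 0 pts i 0) 1.
have /choice[h hP] (i : 'I_D) : exists h : {mpoly K[n.+1]}, h \is m.-homog /\
    forall j, (h.@[pt j] == 0) = (j != i).
  have /choice[w wP] (j : 'I_D) : exists w : {mpoly K[n.+1]},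
      [/\ w \is 1.-homog, w.@[pt i] != 0 & j != i -> w.@[pt j] = 0].
    have [->|ji] := eqVneq j i.
      by exists 'X_ord_max; split=> //;
        rewrite mevalXU /pt /extend_pt unlift_none oner_eq0.
    have [|w w1 [wj wi]] := @separating_form (nth 0 pts j) (nth 0 pts i).
      by rewrite nth_uniq.
    by exists w.
  exists ('X_ord_max ^+ d * \prod_j w j); split.
    apply: dhomogM; first by have := dhomogMn d x1; rewrite mul1n.
    rewrite -[X in X.-homog](_ : \sum_(j < D) 1 = D)%N;
      last by rewrite sum1_card card_ord.
    apply: (big_ind2 (fun e p => p \is e.-homog)) => [|e1 p1 e2 p2|j _];
      first exact: dhomog1.
      exact: dhomogM.
    by have [] := wP j.
  move=> j; rewrite mevalM rmorphXn /= mevalXU {1}/pt {1}/extend_pt unlift_none expr1n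
    mul1r.
  rewrite rmorph_prod prodf_seq_eq0; have [->|ji] := eqVneq j i.
    by apply/negP => /hasP[j' _ /=]; have [_ /negPf->] := wP j'.
  by apply/hasP; exists j; rewrite ?mem_index_enum //=; have [_ _ ->] := wP j.
apply: contrapT => nq.
have : (#|{: option 'I_D}| <= #|{: 'I_t}|)%N.
  apply: (leq_card_indep (ideal_subspace (form_ideal_ideal (G ++ F)))
    (u := fun i => if i is Some i' then h i' else q) (v := b)) => [[i|]|c cI].
  - by apply: span; have [] := hP i.
  - exact: span.
  have cs i : c (Some i) = 0.
    have iZ := pts_zero (mem_nth 0 (ltn_ord i)).
    have := form_ideal_zero iZ cI; rewrite (raddf_sum (meval _)) (bigD1 (Some i)) //=.
    rewrite big1 ?addr0 => [|[j|] /= ji]; rewrite mevalZ.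
    - have [_ /(_ i)] := hP i; rewrite eqxx => hi /eqP.
      by rewrite mulf_eq0 [X in _ || X]hi orbF => /eqP.
    - have [_ /(_ i)] := hP j; rewrite (_ : i != j); last by apply: contraNneq ji => ->.
      by move=> /eqP hj; rewrite [X in _ * X]hj mulr0.
    by rewrite qZ ?mulr0 // mem_nth.
  case=> [i|]; first exact: cs.
  apply/eqP/negPn/negP => c0; apply: nq.
  move: cI; rewrite (bigD1 None) //= big1 ?addr0 => [cqI|[j|] //= _];
    last by rewrite cs scale0r.
  rewrite -[q](scalerK c0) -mul_mpolyC; exact: (idealMl (form_ideal_ideal _)).
rewrite card_option !card_ord.
have := hilb_GF_le m; rewrite -tE -/D; lia.
Qed.

Lemma radical_GF : homog_radical (G ++ F).
Proof.
move=> d p N pd pN; apply: vanish_pts_ideal pd _ => x xp.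
have := form_ideal_zero (pts_zero xp) pN; rewrite rmorphXn /= => /eqP.
by rewrite expf_eq0 => /andP[_ /eqP].
Qed.

Lemma x0_nzd_F : nonzerodivisor_mod F 'X_ord_max.
Proof.
have perm : perm_eq (x0 :: G ++ F) (G ++ x0 :: F) by rewrite perm_sym perm_catC /=
  perm_cons perm_catC.
have fGF := forms_perm perm forms_all.
have rGF := regular_forms_perm perm all_regular.
apply: (@regular_forms_nzd _ _ x0); last exact: regular_forms_suffix fGF rGF.
by move=> y yF; apply: fGF; rewrite mem_cat yF orbT.
Qed.

(** The product [x_n p] vanishes at every zero of the forms, whether or not it
    lies at infinity, so a power of it belongs to the ideal; then [x_n] can be
    cancelled, and [p] extracted from its power. *)
Lemma vanish_locus_ideal d p : p \is d.-homog ->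
  (forall x : 'rV[K]_n, common_zero f x -> p.@[extend_pt (x 0) 1] = 0) -> form_ideal F p.
Proof.
move=> pd pZ; have [|N pN] := @form_nullstellensatz n K F (p * 'X_ord_max).
  move=> v vF; rewrite mevalM mevalXU; have [->|vm] := eqVneq (v ord_max) 0;
    first by rewrite mulr0.
  pose x : 'rV[K]_n := \row_j ((v ord_max)^-1 * v (lift ord_max j)).
  have xv : extend_pt (x 0) 1 =1 (fun i => (v ord_max)^-1 * v i).
    by move=> i; rewrite /extend_pt; case: unliftP => [j|] ->; rewrite ?mxE ?mulVf.
  suff : p.@[extend_pt (x 0) 1] = 0.
    rewrite (meval_eq _ xv) (meval_dhomogZ _ _ pd) => /eqP.
    by rewrite mulf_eq0 expf_eq0 invr_eq0 (negPf vm) andbF => /eqP->; rewrite mul0r.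
  apply: pZ; apply/forallP => i; apply/eqP; move: i; apply/homogenised_family_zero1.
  move=> y yF; have [_ yd] := fF yF.
  by rewrite (meval_eq _ xv) (meval_dhomogZ _ _ yd) vF ?mulr0.
have pN' : form_ideal F (p ^+ N).
  move: pN; rewrite exprMn; elim: {2}N => [|M IHM]; first by rewrite mulr1.
  by rewrite exprSr mulrA => /x0_nzd_F.
exact: homog_radical_suffix forms_GF regular_GF radical_GF d p N pd pN'.
Qed.

Lemma dim_restrictions m : exists2 d : nat,
  has_dim (restrictions m f) d & d%:Z = \sum_(j < m.+1) hilb_coef n k j.
Proof.
have [d [b [dE bm free span]]] := quotient_basis F m.
exists d; last first.
  rewrite dE (regular_forms_suffix forms_GF regular_GF) hilb_coef_sum.
  by rewrite degrees_homogenised_family.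
exists (fun i (x : zero_locus f) => (b i).@[extend_pt (sval x 0) 1]); split.
- move=> i; exists (dehomogenise (b i)); first exact: msize_dehomogenise.
  by move=> x; rewrite meval_dehomogenise.
- move=> c c0; apply: free; apply: (vanish_locus_ideal (d := m)).
    by apply: rpred_sum => i _; apply/rpredZ/bm.
  move=> x xf; rewrite (raddf_sum (meval _)) -[RHS](c0 (exist _ x xf)) /=.
  by apply: eq_bigr => i _; rewrite mevalZ.
move=> phi [p pm phiE]; have [c cI] := span _ (homogenise_homog pm).
exists c => x; rewrite phiE -(meval_homogenise1 m).
have xZ : form_zero F (extend_pt (sval x 0) 1).
  by apply/homogenised_family_zero1 => i; apply/eqP; move: (svalP x) => /forallP.
have := form_ideal_zero xZ cI; rewrite mevalB => /eqP; rewrite subr_eq0 => /eqP->.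
by rewrite (raddf_sum (meval _)); apply: eq_bigr => i _ /=; rewrite mevalZ.
Qed.

End SufficientIntersection.

Theorem theorem3p5 (R : realType) (n s m : nat)
    (k : 'I_s -> nat) (f : 'I_s -> {mpoly R[i][n]}) :
  (1 <= s <= n)%N ->
  (forall i, hypersurface (k i) (f i)) ->
  (forall i, without_multiple_factors (f i)) ->
  sufficiently_intersect k f ->
  exists2 d : nat,
    has_dim (restrictions m f) d &
    d%:Z = \sum_(j < m.+1) hilb_coef n k j.
Proof.
move=> /andP[_ le_sn] hyp_f _ [l [g [hyp_g [pts [uniq_pts size_pts ptsP]]]]].
exact: dim_restrictions le_sn hyp_f hyp_g uniq_pts size_pts ptsP m.
Qed.
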